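(* For all integers $t\ge 4$ and $k\ge 2$, \[ 2^{\frac{1}{2}kt(1-o(1))}\le \binom{r_k(K_{t-1})}{2} \le s_{k,1}\bigl(K^{(3)}_t\bigr) \le k^{20kt^4}, \] where the $o(1)$ term tends to $0$ as $t\to\infty$.
   Context: A $3$-uniform hypergraph $H=(V,E)$ has $E\subseteq\binom{V}{3}$. $K^{(3)}_t$ denotes the complete $3$-uniform hypergraph on $t$ vertices. For hypergraphs $H,F$ and an integer $k$, we write $H\longrightarrow (F)_k$ (``$H$ is $k$-Ramsey for $F$'') if every coloring of $E(H)$ with $k$ colors contains a monochromatic copy of $F$. $H$ is minimal $k$-Ramsey for $F$ if $H\longrightarrow(F)_k$ but no proper subhypergraph of $H$ is $k$-Ramsey for $F$; $\mathcal{M}_k(F)$ is the set of all such minimal $3$-uniform hypergraphs. The degree of a vertex $v$ is the number of edges containing it, and $\delta_1(H)$ is the minimum vertex degree. Define $s_{k,1}(K^{(3)}_t):=\min_{G\in\mathcal{M}_k(K^{(3)}_t)}\delta_1(G)$. $r_k(K_{t-1})$ is the $k$-color graph Ramsey number of the complete graph $K_{t-1}$, i.e. the least $n$ such that every $k$-coloring of $E(K_n)$ contains a monochromatic $K_{t-1}$. *)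

(* Defs.v *)
From mathcomp Require Import all_boot.

Set Implicit Arguments.
Unset Strict Implicit.
Unset Printing Implicit Defensive.

(* An r-uniform hypergraph (V, E) whose finite vertex set V is a subset of an
   ambient finite type T, so that subhypergraphs may drop vertices as well as
   edges.  Graphs are the case r = 2. *)
Record hypergraph (r : nat) (T : finType) := Hypergraph {
  verts : {set T};
  edges : {set {set T}};
  edges_uniform :
    edges \subset [set e : {set T} | (e \subset verts) && (#|e| == r)]
}.

Fact complete_uniform (r n : nat) :
  [set e : {set 'I_n} | #|e| == r] \subset
    [set e : {set 'I_n} | (e \subset [set: 'I_n]) && (#|e| == r)].
Proof. by apply/subsetP => e; rewrite !inE subsetT. Qed.

(* K^(r)_n *)
Definition complete (r n : nat) : hypergraph r 'I_n :=
  Hypergraph (complete_uniform r n).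

Definition subhypergraph (r : nat) (T : finType) (G H : hypergraph r T) : bool :=
  (verts G \subset verts H) && (edges G \subset edges H).

Definition proper_subhypergraph (r : nat) (T : finType)
    (G H : hypergraph r T) : bool :=
  subhypergraph G H && ~~ subhypergraph H G.

Definition monochromatic_copy (r k : nat) (T U : finType)
    (c : {set T} -> 'I_k) (H : hypergraph r T) (F : hypergraph r U) : Prop :=
  exists (f : U -> T) (i : 'I_k),
    [/\ {in verts F &, injective f},
        f @: verts F \subset verts H
      & forall e, e \in edges F -> f @: e \in edges H /\ c (f @: e) = i].

(* H --> (F)_k.  A coloring is a function on all sets of vertices; only its
   values on the edges of H matter. *)
Definition ramsey (r k : nat) (T U : finType)
    (H : hypergraph r T) (F : hypergraph r U) : Prop :=
  forall c : {set T} -> 'I_k, monochromatic_copy c H F.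

(* H \in M_k(F) *)
Definition minimal_ramsey (r k : nat) (T U : finType)
    (H : hypergraph r T) (F : hypergraph r U) : Prop :=
  ramsey k H F /\
  forall G : hypergraph r T, proper_subhypergraph G H -> ~ ramsey k G F.

Definition degree (r : nat) (T : finType) (H : hypergraph r T) (v : T) : nat :=
  #|[set e in edges H | v \in e]|.

(* Every degree is at most #|edges H|, so the default value does not affect
   the minimum unless there is no vertex. *)
Definition min_degree (r : nat) (T : finType) (H : hypergraph r T) : nat :=
  \big[minn/#|edges H|]_(v in verts H) degree H v.

Definition is_least (P : nat -> Prop) (n : nat) : Prop :=
  P n /\ forall m, P m -> n <= m.

(* n = r_k(K_m) *)
Definition is_graph_ramsey_number (k m n : nat) : Prop :=
  is_least (fun N => ramsey k (complete 2 N) (complete 2 m)) n.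

(* s = s_{k,1}(K^(3)_t) *)
Definition is_smallest_min_degree (k t s : nat) : Prop :=
  is_least (fun d => exists (T : finType) (G : hypergraph 3 T),
    minimal_ramsey k G (complete 3 t) /\ min_degree G = d) s.

(* Main.v *)
(* Upper bound.  Call P a pattern if it is a k-edge-coloured triple system on n
   vertices such that for every k-colouring of the pairs of vertices some t-1
   vertices have all their pairs and all their triples present in the same
   colour.  If H is a hypergraph that is not k-Ramsey for K_t, but all of whose
   colourings without monochromatic K_t contain a copy of P up to a permutation
   of the colours, then adding to H, for each copy W of P, a new vertex whose
   link is the complete graph on W yields a Ramsey hypergraph.  All its minimal
   Ramsey subhypergraphs use a new vertex, and new vertices have degree at most
   C(n,2).

   H comes from a Nesetril-Roedl theorem: a k-edge-coloured triple system Q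
   without monochromatic K_t embeds in such a system V so that for each
   colouring of V some copy of Q is coloured according to its colour classes.
   Take for Q the disjoint union of P and of one two-coloured K_t for each pair
   of colours: a map of the colours that identifies two of them makes one of
   these cliques monochromatic.

   P is a union of coloured copies of K_(t-1), chosen greedily so that each of
   them hits a positive fraction of the pair colourings not yet hit while no
   triple lies in two copies and no K_t appears.

   Lower bounds.  If v has degree less than C(r,2) in a minimal hypergraph, its
   link has a homomorphism to a complete graph on fewer than r vertices, so a
   good colouring of G - v extends to v.  The number r_k(K_(t-1)) is bounded from
   below by random colourings for two and three colours and by products. *)
Require Import Defs.
From mathcomp Require Import all_boot boolp zify.

Set Implicit Arguments.
Unset Strict Implicit.
Unset Printing Implicit Defensive.

(** * Ramsey's theorem for sets *)

Lemma subset_of_card (T : finType) (A : {set T}) (m : nat) :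
  m <= #|A| -> exists2 B : {set T}, B \subset A & #|B| = m.
Proof.
rewrite -bin_gt0 -cards_draws card_gt0 => /set0Pn[B].
by rewrite inE => /andP[BA /eqP Bm]; exists B.
Qed.

(** The bound is for colourings of [r.+1]-sets. Its last argument is the sum of the target sizes
    over all colours, which makes [r = 0] the pigeonhole principle. *)
Fixpoint ramsey_bound (k r : nat) : nat -> nat :=
  if r is r'.+1 then
    fix bound n := if n is n'.+1 then (ramsey_bound k r' (k * bound n')).+1 else 0
  else id.

Lemma ramsey_bound2_le (k n : nat) : ramsey_bound k 1 n <= k.+1 ^ n.
Proof.
elim: n => [//|n IHn] /=; rewrite expnS mulSn -addn1 addnC.
by rewrite leq_add ?expn_gt0 // leq_mul2l IHn orbT.
Qed.

(** Outer induction on [r], inner induction on the sum of the targets. A vertex [x] induces a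
    colouring of smaller sets; on a large set where this has a single colour [i], the target of [i]
    may be lowered by one because [x] can be added back. *)
Lemma ramsey_sets (r : nat) (C : finType) (c0 : C) (h : C -> nat)
    (T : finType) (S : {set T}) (c : {set T} -> C) :
  ramsey_bound #|C| r (\sum_i h i) <= #|S| ->
  exists i (A : {set T}), [/\ A \subset S, #|A| = h i &
    forall e : {set T}, e \subset A -> #|e| = r.+1 -> c e = i].
Proof.
elim: r T S c h => [|r IHr] T S c h.
  move=> /= leS; case: (pickP [pred i | h i <= #|[set x in S | c [set x] == i]|]).
    move=> i /= /subset_of_card[A /subsetP AS Ah]; exists i, A; split=> //.
      by apply/subsetP => x /AS; rewrite inE => /andP[].
    move=> e eA /eqP/cards1P[x def_e]; move: eA; rewrite def_e sub1set.
    by move/AS; rewrite inE => /andP[_ /eqP].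
  move=> noi; have: #|S| < \sum_i h i.
    rewrite -sum1_card (partition_big (fun x => c [set x]) predT) //=.
    have lt_h i : \sum_(x in S | c [set x] == i) 1 < h i.
      move: (noi i); rewrite /= ltnNge => /negbT; congr (~~ (_ <= _)).
      by rewrite -sum1_card; apply: eq_bigl => x; rewrite inE.
    rewrite (bigD1 c0) //= [X in _ < X](bigD1 c0) //= -addSn leq_add //.
    by apply: leq_sum => i _; apply: ltnW.
  by rewrite ltnNge leS.
have [n hn] : exists n, \sum_i h i = n by exists (\sum_i h i).
rewrite hn; elim: n T S c h hn => [|n IHn] T S c h hn leS.
  exists c0, set0; split; rewrite ?sub0set ?cards0 //.
    by apply/esym/eqP; rewrite -leqn0 -hn (bigD1 c0) //= leq_addr.
  by move=> e; rewrite subset0 => /eqP->; rewrite cards0.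
case: (pickP [pred i | h i == 0]) => [i /= /eqP hi0|h_gt0].
  exists i, set0; split; rewrite ?sub0set ?cards0 //.
  by move=> e; rewrite subset0 => /eqP->; rewrite cards0.
have /card_gt0P[x Sx]: 0 < #|S| by apply: leq_trans leS.
set M := ramsey_bound #|C| r.+1 n.
have [i [A [AS cardA cA]]] : exists i (A : {set T}), [/\ A \subset S :\ x, #|A| = M &
    forall e : {set T}, e \subset A -> #|e| = r.+1 -> c (x |: e) = i].
  apply: (IHr T (S :\ x) (fun e => c (x |: e)) (fun=> M)).
  by rewrite sum_nat_const -ltnS; move: leS; rewrite (cardsD1 x S) Sx add1n.
have xA : x \notin A by apply/negP => /(subsetP AS); rewrite !inE eqxx.
have {}AS : A \subset S := subset_trans AS (subsetDl _ _).
pose h' j := if j == i then (h i).-1 else h j.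
have hi : h i = (h i).-1.+1 by rewrite prednK // lt0n (negbT (h_gt0 i)).
have h'n : \sum_j h' j = n.
  apply: succn_inj; rewrite -hn (bigD1 i) //= [in RHS](bigD1 i) //= /h' eqxx.
  rewrite -addSn -hi.
  by congr (_ + _); apply: eq_bigr => j /negPf->.
have [|j [B [BA cardB cB]]] := IHn T A c h' h'n; first by rewrite cardA.
have BS := subset_trans BA AS.
have [eij|neij] := eqVneq j i; last first.
  by exists j, B; split=> //; rewrite cardB /h' (negPf neij).
rewrite {j}eij in cardB cB; have xB : x \notin B by apply: contra xA; apply/subsetP.
exists i, (x |: B); split.
- by rewrite subUset sub1set Sx.
- by rewrite cardsU1 xB cardB /h' eqxx add1n -hi.
- move=> e eB cardE; have [xe|xe] := boolP (x \in e); last first.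
    apply: cB => //; apply/subsetP => y ye; have := subsetP eB y ye.
    by rewrite !inE => /predU1P[yx|//]; rewrite -yx ye in xe.
  rewrite -(setD1K xe); apply: cA.
    apply: subset_trans BA; apply/subsetP => y; rewrite !inE => /andP[yx ye].
    by have := subsetP eB y ye; rewrite !inE (negPf yx).
  by apply: succn_inj; rewrite -cardE [in RHS](cardsD1 x) xe.
Qed.

(** * The Hales-Jewett theorem *)

(** Combinatorial lines: [None] marks a running coordinate. That there is one is required
    separately, by [moving]. *)
Definition line (D L : finType) := {ffun D -> option L}.

Definition point (D L : finType) (l : line D L) (a : L) : {ffun D -> L} :=
  [ffun p => odflt a (l p)].

Definition moving (D L : finType) (l : line D L) : Prop := exists p, l p = None.

Definition join (D1 D2 : finType) (X : Type)
    (u : {ffun D1 -> X}) (v : {ffun D2 -> X}) : {ffun D1 + D2 -> X} :=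
  [ffun p => match p with inl p1 => u p1 | inr p2 => v p2 end].

Definition fixed (D L : finType) (w : {ffun D -> L}) : line D L :=
  [ffun p => Some (w p)].

Lemma point_fixed (D L : finType) (w : {ffun D -> L}) a : point (fixed w) a = w.
Proof. by apply/ffunP => p; rewrite !ffunE. Qed.

Lemma point_join (D1 D2 L : finType) (l1 : line D1 L) (l2 : line D2 L) a :
  point (join l1 l2) a = join (point l1 a) (point l2 a).
Proof. by apply/ffunP => -[p|p]; rewrite !ffunE. Qed.

Definition constant_on (D L C : finType) (c : {ffun D -> L} -> C)
    (l : line D L) (S : {set L}) : Prop :=
  {in S &, forall a b, c (point l a) = c (point l b)}.

(** The alphabet [L] stays fixed and only the set of letters on which a line is monochromatic grows,
    so the induction over letters never changes the type. *)
Definition hales_jewett_on (L : finType) (S : {set L}) : Prop :=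
  forall C : finType, exists D : finType, forall c : {ffun D -> L} -> C,
    exists2 l : line D L, moving l & constant_on c l S.

(* Colour focusing: the lines through w with colour i on S, for i in I; every
   new direction enlarges I, which can happen at most #|C| times. *)
Lemma focusing (L : finType) (S : {set L}) (z a0 : L) (C : finType) (r : nat) :
  hales_jewett_on S -> a0 \in S ->
  exists D : finType, forall c : {ffun D -> L} -> C,
    (exists2 l : line D L, moving l & constant_on c l (z |: S)) \/
    exists (w : {ffun D -> L}) (I : {set C}), #|I| = r /\
      {in I, forall i, exists l : line D L, [/\ moving l, point l z = w &
        {in S, forall a, c (point l a) = i}]}.
Proof.
move=> HJ Sa0; elim: r => [|r [D IHD]].
  exists unit => c; right; exists [ffun=> z], set0; split; first exact: cards0.
  by move=> i; rewrite inE.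
have [D' HD'] := HJ {ffun {ffun D -> L} -> C}.
exists (D' + D)%type => c.
(* A point of the new block is coloured by the whole colouring it induces on the old cube, so along
   [l'] the letters of [S] are interchangeable. *)
have [l' ml' cl'] := HD' (fun u => [ffun v => c (join u v)]).
have {cl'} cl' a b v : a \in S -> b \in S ->
    c (join (point l' a) v) = c (join (point l' b) v).
  by move=> Sa Sb; have /ffunP/(_ v) := cl' a b Sa Sb; rewrite !ffunE.
have [[l [p lp] cl]|[w [I [Ir foc]]]] := IHD (fun v => c (join (point l' a0) v)).
  left; exists (join (fixed (point l' a0)) l); first by exists (inr p); rewrite ffunE.
  by move=> a b Sa Sb; rewrite !point_join !point_fixed; apply: cl.
(* If the colour at the focus is already in [I], a focused line of that colour extends to [z].
   Otherwise the focus becomes [join (point l' z) w]: the old lines move together with [l'], and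
   [l'] alone contributes the new colour [i0]. *)
set i0 := c (join (point l' a0) w); have [Ii0|nIi0] := boolP (i0 \in I).
  left; have [l [[p lp] lz cl]] := foc i0 Ii0.
  exists (join (fixed (point l' a0)) l); first by exists (inr p); rewrite ffunE.
  suff cS a : a \in z |: S -> c (point (join (fixed (point l' a0)) l) a) = i0.
    by move=> a b Sa Sb; rewrite !cS.
  rewrite point_join point_fixed => /setU1P[->|Sa]; first by rewrite lz.
  exact: cl.
right; exists (join (point l' z) w), (i0 |: I); split; first by rewrite cardsU1 nIi0 Ir.
have [p' lp'] := ml'; move=> i /setU1P[->|Ii].
  exists (join l' (fixed w)); split; first by exists (inl p'); rewrite ffunE.
    by rewrite point_join point_fixed.
  by move=> a Sa; rewrite point_join point_fixed; apply: cl'.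
have [l [_ lz cl]] := foc i Ii; exists (join l' l); split.
- by exists (inl p'); rewrite ffunE.
- by rewrite point_join lz.
- by move=> a Sa; rewrite point_join (cl' a a0) // cl.
Qed.

Theorem hales_jewett (L C : finType) :
  exists D : finType, forall c : {ffun D -> L} -> C,
    exists2 l : line D L, moving l & forall a b, c (point l a) = c (point l b).
Proof.
suff HJ (S : {set L}) : hales_jewett_on S.
  have [D HD] := HJ setT C; exists D => c; have [l ml cl] := HD c.
  by exists l => // a b; apply: cl.
have [n] := ubnP #|S|; elim: n S => // n IHn S.
have [->|[z Sz]] := set_0Vmem S.
  move=> _ C'; exists unit => c; exists [ffun=> None]; first by exists tt;
    rewrite ffunE.
  by move=> a; rewrite inE.
rewrite ltnS (cardsD1 z) Sz add1n => /IHn HJ C'.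
have [S'0|[a0 Sa0]] := set_0Vmem (S :\ z).
  exists unit => c; exists [ffun=> None]; first by exists tt; rewrite ffunE.
  by rewrite -(setD1K Sz) S'0 => a b; rewrite !inE !orbF => /eqP-> /eqP->.
(* With more colours requested than exist, only the first alternative of [focusing] is left. *)
have [D HD] := focusing z C' #|C'|.+1 HJ Sa0; exists D => c.
have [|[w [I [cardI _]]]] := HD c; first by rewrite setD1K.
by have := max_card (mem I); rewrite cardI ltnn.
Qed.

(** * The partite construction *)

Lemma subset_between (T : finType) (A B : {set T}) (m : nat) :
  B \subset A -> #|B| <= m <= #|A| ->
  exists e : {set T}, [/\ B \subset e, e \subset A & #|e| = m].
Proof.
move=> BA /andP[Bm mA].
have [|C CAB cardC] := @subset_of_card _ (A :\: B) (m - #|B|).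
  by rewrite cardsD (setIidPr BA) leq_sub2r.
exists (B :|: C); split; first exact: subsetUl.
  by rewrite subUset BA (subset_trans CAB) // subsetDl.
rewrite cardsU cardC; have -> : B :&: C = set0.
  apply/setP => x; rewrite !inE; apply/negP => /andP[Bx /(subsetP CAB)].
  by rewrite inE Bx.
by rewrite cards0 subn0 subnKC.
Qed.

(* [None] means that a set is not an edge. *)
Definition triple_coloring (T : finType) (k : nat) (c : {set T} ->
  option 'I_k) : Prop :=
  forall e i, c e = Some i -> #|e| = 3.

Definition mono_clique (T : finType) (k : nat) (c : {set T} -> option 'I_k)
    (A : {set T}) (i : 'I_k) : Prop :=
  forall e : {set T}, e \subset A -> #|e| = 3 -> c e = Some i.

Definition clique_free (t : nat) (T : finType) (k : nat)
    (c : {set T} -> option 'I_k) : Prop :=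
  forall (A : {set T}) i, #|A| = t -> ~ mono_clique c A i.

Definition embedding (Q V : finType) (k : nat) (cQ : {set Q} -> option 'I_k)
    (cV : {set V} -> option 'I_k) (f : Q -> V) : Prop :=
  injective f /\ forall e i, cQ e = Some i -> cV (f @: e) = Some i.

Definition transversal_coloring (T I : finType) (k : nat)
    (c : {set T} -> option 'I_k) (part : T -> I) : Prop :=
  forall e i, c e = Some i -> {in e &, injective part}.

Lemma embedding_comp (Q V W : finType) (k : nat) (cQ : {set Q} -> option 'I_k)
    (cV : {set V} -> option 'I_k) (cW : {set W} -> option 'I_k) f g :
  embedding cQ cV f -> embedding cV cW g -> embedding cQ cW (g \o f).
Proof.
move=> [fI cf] [gI cg]; split; first exact: inj_comp.
by move=> e i /cf/cg; rewrite -imset_comp.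
Qed.

(** * Amalgamation over one triple of parts *)

Section PartiteStep.

Variables (k t : nat) (i : 'I_k) (T I : finType).
Variables (c : {set T} -> option 'I_k) (part : T -> I) (d : {set I}) (D : finType).

Hypotheses (t_gt3 : 3 < t) (c_triple : triple_coloring c) (c_free : clique_free t c)
  (c_trans : transversal_coloring c part) (card_d : #|d| = 3).

Definition letter := {e : {set T} | (c e == Some i) && (part @: e == d)}.

Definition letter_set (f : letter) : {set T} := val f.

Lemma letterP (f : letter) : c (letter_set f) = Some i /\ part @: letter_set f = d.
Proof. by case/andP: (valP f) => /eqP ? /eqP ?. Qed.

Definition vertex_in (f : letter) (a : I) : option T :=
  [pick x | (x \in letter_set f) && (part x == a)].

Lemma vertex_in_part (f : letter) (x : T) :
  x \in letter_set f -> vertex_in f (part x) = Some x.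
Proof.
move=> fx; rewrite /vertex_in; case: pickP => [y /andP[fy /eqP eq_yx]|/(_ x)].
  by congr Some; apply: (c_trans (letterP f).1).
by rewrite fx eqxx.
Qed.

Lemma vertex_inP (f : letter) (a : I) :
  a \in d -> exists2 x, vertex_in f a = Some x & (x \in letter_set f) /\ part x = a.
Proof.
have [_ fd] := letterP f => ad.
have /imsetP[x fx ->] : a \in part @: letter_set f by rewrite fd.
by exists x; rewrite ?vertex_in_part.
Qed.

(** Vertices over the parts in [d] are words; [option] reflects that [vertex_in] is partial, and
    words lying in no copy are isolated. *)
Definition step_type := ({ffun D -> option T} + line D letter * T)%type.

(* The copy of the system attached to the line l: the vertices in the parts of d
   move along l, the other ones are private to l. *)
Definition copy (l : line D letter) (x : T) : step_type :=
  if part x \in d then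
    inl [ffun p => if l p is Some f then vertex_in f (part x) else Some x]
  else inr (l, x).

Lemma copy_out l x : part x \notin d -> copy l x = inr (l, x).
Proof. by rewrite /copy => /negPf->. Qed.

Lemma copy_in l x : part x \in d ->
  copy l x = inl [ffun p => if l p is Some f then vertex_in f (part x) else Some x].
Proof. by rewrite /copy => ->. Qed.

Lemma copy_inj l : moving l -> injective (copy l).
Proof.
move=> [p lp] x y; have [xd|xd] := boolP (part x \in d);
  have [yd|yd] := boolP (part y \in d); rewrite ?(copy_in l xd) ?(copy_in l yd)
    ?(copy_out l xd) ?(copy_out l yd) //.
  by case=> /ffunP/(_ p); rewrite !ffunE lp => -[].
by case.
Qed.

Lemma copy_eq_part l l' x y : moving l -> copy l x = copy l' y -> part x = part y.
Proof.
move=> [p lp]; have [xd|xd] := boolP (part x \in d);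
  have [yd|yd] := boolP (part y \in d); rewrite ?(copy_in _ xd) ?(copy_in _ yd)
    ?(copy_out _ xd) ?(copy_out _ yd) //; last by case=> _ ->.
case=> /ffunP/(_ p); rewrite !ffunE lp.
case: (l' p) => [f|]; last by case=> ->.
by have [z -> [_ <-]] := vertex_inP f yd => -[->].
Qed.

(** Distinct copies meet only over [d]. At a coordinate where [l] moves, [copy l x] shows [x]
    itself; there [l'] either moves too, which gives [e = e'], or shows a fixed letter, which must
    then be [e]. *)
Lemma copy_edge l l' (e e' : {set T}) : moving l -> moving l' -> #|e| = 3 -> l <> l' ->
  copy l @: e = copy l' @: e' -> e = e' \/ exists f : letter, e = letter_set f.
Proof.
move=> ml ml' e3 ll' eq_ee'; have [p lp] := ml.
have sub x : x \in e -> exists2 y, y \in e' & copy l x = copy l' y.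
  by move=> ex; have := imset_f (copy l) ex; rewrite eq_ee' => /imsetP.
have in_d x y : copy l x = copy l' y -> part x \in d /\ part y \in d.
  move=> eq_xy; rewrite -(copy_eq_part ml eq_xy); suff: part x \in d by [].
  apply/negPn/negP => xd; apply: ll'.
  have yd : part y \notin d by rewrite -(copy_eq_part ml eq_xy).
  by move: eq_xy; rewrite (copy_out _ xd) (copy_out _ yd) => -[].
case def_f: (l' p) => [f|].
  right; exists f; apply/eqP; rewrite eqEcard e3 (c_triple (letterP f).1) leqnn andbT.
  apply/subsetP => x /sub[y _ eq_xy]; have [xd yd] := in_d x y eq_xy.
  move: eq_xy; rewrite (copy_in l xd) (copy_in l' yd) => -[/ffunP/(_ p)].
  by rewrite !ffunE lp def_f; have [z -> [fz _]] := vertex_inP f yd => -[->].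
left; apply/eqP; rewrite eqEcard -(card_imset e (copy_inj ml)) eq_ee'.
rewrite card_imset ?leqnn ?andbT; last exact: copy_inj.
apply/subsetP => x /sub[y ye' eq_xy]; have [xd yd] := in_d x y eq_xy.
move: eq_xy; rewrite (copy_in l xd) (copy_in l' yd) => -[/ffunP/(_ p)].
by rewrite !ffunE lp def_f => -[->].
Qed.

(** Letters all have colour [i], so overlapping copies agree. As [e] is not assumed to be an edge,
    this also shows that copies are induced, which the clique argument uses. *)
Lemma copy_compat l l' (e e' : {set T}) j : moving l -> moving l' ->
  copy l @: e = copy l' @: e' -> c e' = Some j -> c e = Some j.
Proof.
move=> ml ml' eq_ee' ce'; have e'3 := c_triple ce'.
have e3 : #|e| = 3.
  by rewrite -(card_imset e (copy_inj ml)) eq_ee' card_imset //; apply: copy_inj.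
have [ll'|nll'] := eqVneq l l'.
  by rewrite -ll' in eq_ee'; rewrite (imset_inj (copy_inj ml) eq_ee').
have ll' : l <> l' by move=> eq_l; rewrite eq_l eqxx in nll'.
have [->//|[f ef]] := copy_edge ml ml' e3 ll' eq_ee'.
have l'l : l' <> l by move=> eq_l; apply: ll'.
have [<-//|[f' e'f']] := copy_edge ml' ml e'3 l'l (esym eq_ee').
by rewrite -ce' ef e'f' !(letterP _).1.
Qed.

Definition moving_copy (e' : {set step_type}) :
    pred (line D letter * {set T}) :=
  fun u => [&& [exists p, u.1 p == None], c u.2 != None & e' == copy u.1 @: u.2].

Definition step_coloring (e' : {set step_type}) : option 'I_k :=
  if [pick u | moving_copy e' u] is Some u then c u.2 else None.

Lemma step_coloring_copy l e j : moving l -> c e = Some j ->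
  step_coloring (copy l @: e) = Some j.
Proof.
move=> ml ce; rewrite /step_coloring; case: pickP => [[l' e']|/(_ (l, e))].
  case/and3P => /= /existsP[p /eqP l'p] _ /eqP eq_ee'.
  by apply: copy_compat (esym eq_ee') ce; [exists p | exact: ml].
rewrite /moving_copy /= ce eqxx /= !andbT => /negbT/existsP[].
by have [p lp] := ml; exists p; rewrite lp.
Qed.

Lemma step_coloringP e' j : step_coloring e' = Some j ->
  exists l e, [/\ moving l, c e = Some j & e' = copy l @: e].
Proof.
rewrite /step_coloring; case: pickP => [[l e]|//] /=.
by case/and3P => /= /existsP[p /eqP lp] _ /eqP-> ce; exists l, e; split=> //; exists p.
Qed.

Lemma step_triple : triple_coloring step_coloring.
Proof.
move=> e' j /step_coloringP[l [e [ml ce ->]]].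
by rewrite card_imset ?(c_triple ce) //; apply: copy_inj.
Qed.

Variables (p0 : D) (a0 : I).

(** All coordinates of a word in a copy lie in the same part, so one fixed coordinate [p0] suffices;
    [a0] is a default that no copy meets. *)
Definition step_part (x' : step_type) : I :=
  match x' with
  | inl w => if w p0 is Some x then part x else a0
  | inr (_, x) => part x
  end.

Lemma step_part_copy l x : step_part (copy l x) = part x.
Proof.
have [xd|xd] := boolP (part x \in d); last by rewrite copy_out.
rewrite copy_in //= ffunE; case: (l p0) => [f|//].
by have [z -> []] := vertex_inP f xd.
Qed.

Lemma step_transversal : transversal_coloring step_coloring step_part.
Proof.
move=> e' j /step_coloringP[l [e [ml ce ->]]] _ _ /imsetP[x ex ->] /imsetP[y ey ->].
by rewrite !step_part_copy => eq_xy; congr copy; apply: (c_trans ce).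
Qed.

(** Vertices of a clique lie in distinct parts, and [t > 3 = #|d|], so one of them is outside [d].
    It is private to one line; hence all triples through it, and so the whole clique, lie in a
    single copy. *)
Lemma step_clique_free : clique_free t step_coloring.
Proof.
move=> A j cardA monoA.
have A3 x y : x \in A -> y \in A -> exists e : {set step_type},
    [/\ x \in e, y \in e, e \subset A & #|e| = 3].
  move=> Ax Ay; have [||e [xye eA e3]] := @subset_between _ A [set x; y] 3.
  - by rewrite subUset !sub1set Ax.
  - by rewrite cards2 cardA (ltnW t_gt3); case: (_ != _).
  by exists e; split=> //; apply: (subsetP xye); rewrite !inE eqxx ?orbT.
have partI : {in A &, injective step_part}.
  move=> x y Ax Ay; have [e [ex ey eA e3]] := A3 x y Ax Ay.
  exact: (step_transversal (monoA e eA e3)).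
have [x Ax xd] : exists2 x, x \in A & step_part x \notin d.
  case: (pickP [pred x | (x \in A) && (step_part x \notin d)]) => [x /andP[]|Ad].
    by exists x.
  have : step_part @: A \subset d.
    by apply/subsetP => _ /imsetP[x Ax ->]; have := Ad x; rewrite /= Ax => /negbFE.
  by move/subset_leq_card; rewrite card_in_imset // cardA card_d leqNgt t_gt3.
have copyA y : y \in A -> exists l y', [/\ moving l, y = copy l y'
  & exists x', x = inr (l, x')].
  move=> Ay; have [e [ex ey eA e3]] := A3 x y Ax Ay.
  have [l [e0 [ml _ def_e]]] := step_coloringP (monoA e eA e3).
  move: ex ey; rewrite def_e => /imsetP[x' _ def_x] /imsetP[y' _ def_y].
  exists l, y'; split=> //; exists x'; rewrite def_x copy_out //.
  by rewrite -(step_part_copy l) -def_x.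
have [l [_ [ml _ [x' def_x]]]] := copyA x Ax.
have {}copyA : copy l @: (copy l @^-1: A) = A.
  apply/setP => y; apply/imsetP/idP => [[z]|Ay]; first by rewrite inE => Az ->.
  have [l' [y' [_ def_y [x2]]]] := copyA y Ay.
  by rewrite def_x => -[ll' _]; exists y'; rewrite ?inE ll' -?def_y.
apply: (c_free (A := copy l @^-1: A) (i := j)).
  by rewrite -(card_imset _ (copy_inj ml)) copyA.
move=> e0 e0A e03; have [|l1 [e1 [ml1 ce1 eq_e]]] := @step_coloringP (copy l @: e0) j.
  apply: monoA; last by rewrite card_imset //; apply: copy_inj.
  by rewrite -copyA imsetS.
exact: copy_compat eq_e ce1.
Qed.

Lemma step_embedding l : moving l -> embedding c step_coloring (copy l).
Proof.
by move=> ml; split; [apply: copy_inj | move=> e j; apply: step_coloring_copy].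
Qed.

Definition word_edge (w : {ffun D -> letter}) : {set step_type} :=
  [set inl [ffun p => vertex_in (w p) a] | a in d].

(** A colouring of edges can thus be read as a colouring of words, and a monochromatic line of words
    is a copy whose [i]-edges over [d] have one colour. *)
Lemma copy_letter l (f : letter) : copy l @: letter_set f = word_edge (point l f).
Proof.
have [_ fd] := letterP f.
have -> : word_edge (point l f) =
    [set inl [ffun p => vertex_in (point l f p) a]
      | a in part @: letter_set f] by rewrite fd.
rewrite -imset_comp; apply: eq_in_imset => x fx.
have xd : part x \in d by rewrite -fd imset_f.
rewrite copy_in //=; congr inl; apply/ffunP => p.
by rewrite !ffunE; case: (l p) => [//|] /=; rewrite vertex_in_part.
Qed.

End PartiteStep.

Definition partite_system (k t : nat) (T I : finType) (c : {set T} -> option 'I_k)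
    (part : T -> I) : Prop :=
  [/\ triple_coloring c, clique_free t c & transversal_coloring c part].

Definition part_embedding (k : nat) (T T' I : finType) (c : {set T} -> option 'I_k)
    (part : T -> I) (c' : {set T'} -> option 'I_k) (part' : T' -> I) f : Prop :=
  embedding c c' f /\ part' \o f =1 part.

Lemma partite_step (k t : nat) (i : 'I_k) (T I : finType)
    (c : {set T} -> option 'I_k) (part : T -> I) (d : {set I}) :
  3 < t -> #|d| = 3 -> partite_system t c part ->
  exists (T' : finType) (c' : {set T'} -> option 'I_k) (part' : T' -> I),
    partite_system t c' part' /\
    forall chi : {set T'} -> 'I_k, exists f, part_embedding c part c' part' f /\
      exists j, forall e, c e = Some i -> part @: e = d -> chi (f @: e) = j.
Proof.
move=> t_gt3 d3 [c3 cf ct].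
have [D HD] := hales_jewett (letter i c part d) 'I_k.
have [p0 _] : exists p0 : D, true by have [l [p _] _] := HD (fun=> i); exists p.
have [a0 _] : exists a0, a0 \in d by apply/card_gt0P; rewrite d3.
exists (step_type i c part d D), (@step_coloring k i T I c part d D),
  (@step_part k i T I c part d D p0 a0).
split.
  by split; [apply: step_triple | apply: step_clique_free | apply: step_transversal].
move=> chi; have [l ml cl] := HD (fun w => chi (word_edge w)).
exists (copy l); split; first split; first exact: step_embedding.
  by move=> x; apply: step_part_copy.
case: (pickP [pred e | (c e == Some i) && (part @: e == d)]) => [e0 /= e0P|noe].
  exists (chi (copy l @: e0)) => e ce pe.
  have eP : (c e == Some i) && (part @: e == d) by rewrite ce pe !eqxx.
  have -> : e = letter_set (exist _ e eP : letter i c part d) by [].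
  have -> : e0 = letter_set (exist _ e0 e0P : letter i c part d) by [].
  by rewrite !copy_letter.
by exists i => e ce pe; have := noe e; rewrite /= ce pe !eqxx.
Qed.

(** The step for [d] is built last but its embedding is chosen first; the colouring pulled back
    along it is left to the induction hypothesis. *)
Lemma partite_iter (k t : nat) (i : 'I_k) (T I : finType)
    (c : {set T} -> option 'I_k) (part : T -> I) (ds : seq {set I}) :
  3 < t -> (forall d : {set I}, d \in ds -> #|d| = 3) -> partite_system t c part ->
  exists (T' : finType) (c' : {set T'} -> option 'I_k) (part' : T' -> I),
    partite_system t c' part' /\
    forall chi : {set T'} -> 'I_k, exists f, part_embedding c part c' part' f /\
      exists psi : {set I} -> 'I_k, forall e, c e = Some i ->
        part @: e \in ds -> chi (f @: e) = psi (part @: e).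
Proof.
move=> t_gt3 ds3 sys; elim: ds ds3 => [_|d ds IHds ds3].
  exists T, c, part; split=> // chi; exists id; split; last by exists (fun=> i).
  by split=> //; split=> // e j; rewrite imset_id.
have [|T1 [c1 [part1 [sys1 arrow1]]]] := IHds.
  by move=> d' d'ds; apply: ds3; rewrite inE d'ds orbT.
have [|T2 [c2 [part2 [sys2 arrow2]]]] := partite_step i (d := d) t_gt3 _ sys1.
  by apply: ds3; rewrite inE eqxx.
exists T2, c2, part2; split=> // chi.
have [g [[gE gpart] [j gj]]] := arrow2 chi.
have [f [[fE fpart] [psi fpsi]]] := arrow1 (fun e => chi (g @: e)).
exists (g \o f); split.
  split; first exact: embedding_comp fE gE.
  by move=> x; apply: etrans (gpart (f x)) (fpart x).
exists (fun d' => if d' == d then j else psi d') => e ce.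
have fe : part1 @: (f @: e) = part @: e by rewrite -imset_comp; apply: eq_imset.
rewrite inE imset_comp; case: eqP => [ed _|_ /= eds]; last exact: fpsi.
by apply: gj; rewrite ?fe //; apply: fE.2.
Qed.

(** * Disjoint unions of coloured systems *)

Section DisjointUnion.

Variables (k t : nat) (S X : finType) (c : S -> {set X} -> option 'I_k).
Hypotheses (t_gt2 : 2 < t) (c_triple : forall s, triple_coloring (c s))
  (c_free : forall s, clique_free t (c s)).

Definition union_coloring (E : {set S * X}) : option 'I_k :=
  if [pick s | E \subset [set u | u.1 == s]] is Some s then c s (snd @: E) else None.

Lemma pair_inj (s : S) : injective (pair s : X -> S * X).
Proof. by move=> x y []. Qed.

Lemma union_coloringP E i : union_coloring E = Some i ->
  exists s (e : {set X}), E = pair s @: e /\ c s e = Some i.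
Proof.
rewrite /union_coloring; case: pickP => [s Es ce|//].
exists s, (snd @: E); split=> //; rewrite -imset_comp -[LHS]imset_id.
by apply: eq_in_imset => -[s' x] /(subsetP Es); rewrite inE /= => /eqP->.
Qed.

(** The empty set lies in every slice, so the slice picked for it would be arbitrary. *)
Lemma union_coloring_pair (s : S) (e : {set X}) : e != set0 ->
  union_coloring (pair s @: e) = c s e.
Proof.
case/set0Pn => x ex; rewrite /union_coloring; case: pickP => [s' /subsetP es'|/(_ s)].
  have := es' (s, x) (imset_f _ ex); rewrite inE /= => /eqP<-.
  by rewrite -imset_comp; congr c; rewrite -[RHS]imset_id; apply: eq_imset.
by case/negP; apply/subsetP => _ /imsetP[y _ ->]; rewrite inE.
Qed.

Lemma union_triple : triple_coloring union_coloring.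
Proof.
move=> E i /union_coloringP[s [e [-> ce]]].
by rewrite card_imset ?(c_triple ce) //; apply: pair_inj.
Qed.

Lemma union_clique_free : clique_free t union_coloring.
Proof.
move=> A i cardA monoA; have [x Ax] : exists x, x \in A.
  by apply/card_gt0P; rewrite cardA (leq_trans _ t_gt2).
have sliceA y : y \in A -> y.1 = x.1.
  move=> Ay; have [||e [xye eA e3]] := @subset_between _ A [set x; y] 3.
  - by rewrite subUset !sub1set Ax.
  - by rewrite cards2 cardA t_gt2; case: (_ != _).
  have [g [e0 [def_e _]]] := union_coloringP (monoA e eA e3).
  have : x \in e by rewrite (subsetP xye) // !inE eqxx.
  have : y \in e by rewrite (subsetP xye) // !inE eqxx orbT.
  by rewrite def_e => /imsetP[y' _ ->] /imsetP[x' _ ->].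
have defA : pair x.1 @: (snd @: A) = A.
  rewrite -imset_comp -[RHS]imset_id; apply: eq_in_imset => -[h y] /sliceA/=.
  by move=> ->.
apply: (c_free (s := x.1) (A := snd @: A) (i := i)).
  by rewrite -(card_imset _ (@pair_inj x.1)) defA.
move=> e eA e3; rewrite -union_coloring_pair; last by rewrite -card_gt0 e3.
apply: monoA; last by rewrite card_imset //; apply: pair_inj.
by rewrite -defA imsetS.
Qed.

End DisjointUnion.

(** The construction starts with a copy of [Q] for every injection of [Q] into [N] parts. Once the
    colour of an [i]-edge depends only on its projection, Ramsey's theorem for triples of parts
    gives [#|Q|] parts on which it is constant, and the copy placed there is the one sought. *)
Lemma one_color_arrow (k t : nat) (i : 'I_k) (Q : finType) (c : {set Q} ->
  option 'I_k) :
  3 < t -> triple_coloring c -> clique_free t c ->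
  exists (V : finType) (cV : {set V} -> option 'I_k),
    [/\ triple_coloring cV, clique_free t cV &
    forall chi : {set V} -> 'I_k, exists2 f, embedding c cV f &
      exists j, forall e, c e = Some i -> chi (f @: e) = j].
Proof.
move=> t_gt3 c3 cf; set N := ramsey_bound #|'I_k| 2 (\sum_(j : 'I_k) #|Q|).
(* Non-injective index maps get the empty system, which keeps the union transversal. *)
pose cg (g : {ffun Q -> 'I_N}) (e : {set Q}) := if injectiveb g then c e else None.
pose index_part (u : {ffun Q -> 'I_N} * Q) := u.1 u.2.
have sys : partite_system t (union_coloring cg) index_part.
  split.
  - by apply: union_triple => g e j; rewrite /cg; case: ifP => // _; apply: c3.
  - apply: union_clique_free (ltnW t_gt3) _ => g A j cardA.
    rewrite /cg; case: (injectiveb g) => mono; first exact: (cf A j).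
    have [|e eA e3] := @subset_of_card _ A 3; first by rewrite cardA ltnW.
    by have := mono e eA e3.
  - move=> E j /union_coloringP[g [e [-> ]]]; rewrite /cg;
    case: ifP => // /injectiveP gI _.
    by move=> _ _ /imsetP[x _ ->] /imsetP[y _ ->]; rewrite /index_part /= => /gI->.
have [|V [cV [partV [[cV3 cVf _] arrow]]]] :=
  partite_iter i (ds := enum [set d : {set 'I_N} | #|d| == 3]) t_gt3 _ sys.
  by move=> d; rewrite mem_enum inE => /eqP.
exists V, cV; split=> // chi; have [f [[fE _] [psi fpsi]]] := arrow chi.
have [|j [A [_ cardA monoA]]] := @ramsey_sets 2 _ i (fun=> #|Q|) _ [set: 'I_N] psi.
  by rewrite cardsT [X in _ <= X]card_ord.
have [g gI gA] : exists2 g : Q -> 'I_N, injective g & forall x, g x \in A.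
  exists (fun x => enum_val (cast_ord (esym cardA) (enum_rank x))).
    by move=> x y /enum_val_inj/cast_ord_inj/enum_rank_inj.
  by move=> x; apply: enum_valP.
have fgI : injective (finfun g) by move=> x y; rewrite !ffunE => /gI.
have ne0 e j' : c e = Some j' -> e != set0 by move=> ce; rewrite -card_gt0 (c3 _ _ ce).
exists (f \o pair (finfun g)).
  apply: embedding_comp fE; split; first exact: pair_inj.
  move=> e j' ce; rewrite union_coloring_pair ?(ne0 _ _ ce) //.
  by rewrite /cg (introT (injectiveP _) fgI).
exists j => e ce; rewrite imset_comp.
have def_ge : index_part @: (pair (finfun g) @: e) = g @: e.
  by rewrite -imset_comp; apply: eq_imset => x; rewrite /= /index_part /= ffunE.
have ge3 : #|g @: e| = 3 by rewrite card_imset // (c3 _ _ ce).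
rewrite fpsi; last by rewrite def_ge mem_enum inE ge3.
  rewrite def_ge; apply: monoA => //.
  by apply/subsetP => _ /imsetP[x _ ->].
by rewrite union_coloring_pair ?(ne0 _ _ ce) // /cg (introT (injectiveP _) fgI).
Qed.

(** Colours are treated one at a time. Each new system arrows the previous one by a colour
    preserving embedding, so colours already made uniform remain so. *)
Theorem all_colors_arrow (k t : nat) (Q : finType) (c : {set Q} -> option 'I_k) :
  3 < t -> 0 < k -> triple_coloring c -> clique_free t c ->
  exists (V : finType) (cV : {set V} -> option 'I_k),
    [/\ triple_coloring cV, clique_free t cV &
    forall chi : {set V} -> 'I_k, exists2 f, embedding c cV f &
      exists pi : 'I_k -> 'I_k, forall e i, c e = Some i -> chi (f @: e) = pi i].
Proof.
move=> t_gt3 k_gt0 c3 cf.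
suff [V [cV [cV3 cVf arrow]]] : exists (V : finType) (cV : {set V} -> option 'I_k),
    [/\ triple_coloring cV, clique_free t cV &
    forall chi : {set V} -> 'I_k, exists2 f, embedding c cV f &
      exists pi : 'I_k -> 'I_k, forall e i, i \in enum 'I_k -> c e = Some i ->
        chi (f @: e) = pi i].
  exists V, cV; split=> // chi; have [f fE [pi fpi]] := arrow chi.
  by exists f => //; exists pi => e i; apply: fpi; rewrite mem_enum.
elim: (enum _) => [|j js [V [cV [cV3 cVf arrow]]]].
  exists Q, c; split=> // chi; exists id; last by exists id.
  by split=> // e i; rewrite imset_id.
have [W [cW [cW3 cWf arrowW]]] := one_color_arrow j t_gt3 cV3 cVf.
exists W, cW; split=> // chi; have [g gE [j' gj]] := arrowW chi.
have [f fE [pi fpi]] := arrow (fun e => chi (g @: e)).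
exists (g \o f); first exact: embedding_comp fE gE.
exists (fun i => if i == j then j' else pi i) => e i; rewrite inE imset_comp.
case: eqP => [-> _ ce|_ /= ijs ce]; last exact: fpi.
by apply: gj; apply: fE.2.
Qed.

(** * Sparse families of blocks *)

Lemma card_bigcup_le (I T : finType) (P : pred I) (F : I -> {set T}) :
  #|\bigcup_(i | P i) F i| <= \sum_(i | P i) #|F i|.
Proof.
elim/big_rec2: _ => [|i m A _ Am]; first by rewrite cards0.
by apply: leq_trans (leq_card_setU _ _) _; rewrite leq_add2l.
Qed.

Lemma leq_sum_const (I : finType) (P : pred I) (F : I -> nat) (b : nat) :
  (forall i, P i -> F i <= b) -> \sum_(i | P i) F i <= #|P| * b.
Proof. by move=> Fb; rewrite -sum_nat_const; apply: leq_sum. Qed.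

(** The values of [g] off the image of [q] are free; the factor [#|X| ^ #|D|] avoids a subtraction
    in the exponent. *)
Lemma card_comp_fiber (D E X : finType) (q : D -> E) (w : {ffun D -> X}) :
  injective q ->
  #|[set g : {ffun E -> X} | [ffun j => g (q j)] == w]| * #|X| ^ #|D| = #|X| ^ #|E|.
Proof.
move=> qI; pose F e : pred X := [pred y | [forall j, (q j == e) ==> (y == w j)]].
have -> : #|[set g : {ffun E -> X} | [ffun j => g (q j)] == w]| = #|family F|.
  apply: eq_card => g; rewrite !inE; apply/eqP/familyP => [gw e|gF].
    by apply/forallP => j; apply/implyP => /eqP<-; rewrite -gw ffunE.
  apply/ffunP => j; rewrite ffunE; have := gF (q j).
  by move=> /forallP/(_ j)/implyP/(_ (eqxx _))/eqP.
rewrite card_family foldrE big_map big_enum /=.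
rewrite (bigID (mem (codom q))) /= big1 => [|e /codomP[j ->]]; last first.
  apply/eqP; rewrite -(card1 (w j)); apply/eqP; apply: eq_card => y.
  apply/forallP/eqP => [/(_ j)|-> j']; first by rewrite eqxx => /eqP.
  by apply/implyP => /eqP/qI->.
rewrite mul1n (eq_bigr (fun=> #|X|)) => [|e eq].
  rewrite prod_nat_const -expnD -(card_codom qI) addnC; congr (_ ^ _).
  by rewrite -(cardC (mem (codom q))).
apply: eq_card => y; apply/forallP => j; apply/implyP => /eqP qj.
by rewrite -qj codom_f in eq.
Qed.

Lemma card_comp_in (D E X : finType) (q : D -> E) (B : {set {ffun D -> X}}) :
  injective q ->
  #|[set g : {ffun E -> X} | [ffun j => g (q j)] \in B]| * #|X| ^ #|D|
    = #|B| * #|X| ^ #|E|.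
Proof.
move=> qI; rewrite -sum1_card; set h := fun g : {ffun E -> X} => [ffun j => g (q j)].
rewrite (partition_big h (mem B)) /=; last by move=> g; rewrite inE.
rewrite big_distrl /= -sum_nat_const; apply: eq_bigr => w Bw.
rewrite -(card_comp_fiber w qI) sum1dep_card; congr (_ * _); apply: eq_card => g.
rewrite !inE -/(h g); apply/andP/idP => [[]//|gw]; split=> //.
by move/eqP: gw; rewrite /h => ->.
Qed.

Lemma card_comp3 (E X : finType) (B : {set X * X * X}) (p1 p2 p3 : E) :
  uniq [:: p1; p2; p3] ->
  #|[set g : {ffun E -> X} | (g p1, g p2,
    g p3) \in B]| * #|X| ^ 3 <= #|B| * #|X| ^ #|E|.
Proof.
move=> up; pose q := tnth [tuple p1; p2; p3].
have qI : injective q by apply/tuple_uniqP.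
pose h (w : {ffun 'I_3 -> X}) := (w ord0, w (lift ord0 ord0),
  w (lift ord0 (lift ord0 ord0))).
have hI : injective h.
  move=> w w' [e0 e1 e2]; apply/ffunP => j.
  case: (unliftP ord0 j) => [j1|] ->//; case: (unliftP ord0 j1) => [j2|] ->//.
  by rewrite ord1.
have := card_comp_in (h @^-1: B) qI; rewrite card_ord => eqB.
apply: (@leq_trans (#|h @^-1: B| * #|X| ^ #|E|)); last first.
  rewrite leq_mul2r; apply/orP; right; rewrite -(card_imset _ hI).
  by apply: subset_leq_card; apply/subsetP => _ /imsetP[w + ->]; rewrite inE.
rewrite -eqB leq_mul2r; apply/orP; right; apply: subset_leq_card.
by apply/subsetP => g; rewrite !inE /h !ffunE.
Qed.

Lemma card_comp2 (E X : finType) (B : {set X * X}) (p1 p2 : E) : p1 != p2 ->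
  #|[set g : {ffun E -> X} | (g p1, g p2) \in B]| * #|X| ^ 2 <= #|B| * #|X| ^ #|E|.
Proof.
move=> p12; pose q := tnth [tuple p1; p2].
have qI : injective q by apply/tuple_uniqP; rewrite /= inE p12.
pose h (w : {ffun 'I_2 -> X}) := (w ord0, w (lift ord0 ord0)).
have hI : injective h.
  move=> w w' [e0 e1]; apply/ffunP => j.
  by case: (unliftP ord0 j) => [j1|] ->//; rewrite ord1.
have := card_comp_in (h @^-1: B) qI; rewrite card_ord => eqB.
apply: (@leq_trans (#|h @^-1: B| * #|X| ^ #|E|)); last first.
  rewrite leq_mul2r; apply/orP; right; rewrite -(card_imset _ hI).
  by apply: subset_leq_card; apply/subsetP => _ /imsetP[w + ->]; rewrite inE.
rewrite -eqB leq_mul2r; apply/orP; right; apply: subset_leq_card.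
by apply/subsetP => g; rewrite !inE /h !ffunE.
Qed.

Lemma card_noninjective (E X : finType) :
  #|[set g : {ffun E -> X} | ~~ injectiveb g]| * #|X| <= #|E| ^ 2 * #|X| ^ #|E|.
Proof.
pose B p := [set g : {ffun E -> X} | (g p.1, g p.2) \in [set u : X * X | u.1 == u.2]].
apply: (@leq_trans (#|\bigcup_(p : E * E | p.1 != p.2) B p| * #|X|)).
  rewrite leq_mul2r; apply/orP; right; apply: subset_leq_card; apply/subsetP => g.
  rewrite inE => /injectivePn[x [y xy gxy]].
  by apply/bigcupP; exists (x, y); rewrite // !inE gxy.
apply: leq_trans (leq_mul (card_bigcup_le _ _) (leqnn _)) _.
rewrite big_distrl /= -mulnn -card_prod.
apply: leq_trans (leq_sum_const (b := #|X| ^ #|E|) _) _; last first.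
  by rewrite leq_mul2r max_card orbT.
have diag : #|[set u : X * X | u.1 == u.2]| = #|X|.
  rewrite -(card_imset xpredT (_ : injective (fun x => (x, x)))); last by move=> x y [].
  apply: eq_card => -[x y]; rewrite inE /=; apply/eqP/imsetP => [->|[z _ [-> ->]]] //.
  by exists y.
move=> p p12; have := card_comp2 [set u : X * X | u.1 == u.2] p12; rewrite diag.
case: (posnP #|X|) => [->|X0]; first by rewrite muln0.
by rewrite -mulnn mulnA [X in _ <= X]mulnC leq_pmul2r.
Qed.

Lemma symmetric_set_fun (T : finType) (C : Type) (i0 : C) (f : T -> T -> C) :
  (forall a b, f a b = f b a) ->
  exists c : {set T} -> C, forall a b, a != b -> c [set a; b] = f a b.
Proof.
move=> fC; exists (fun e : {set T} => if [pick u : T * T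
  | (u.1 != u.2) && (e == [set u.1; u.2])]
  is Some u then f u.1 u.2 else i0) => a b ab.
case: pickP => [[a' b'] /= /andP[ab' /eqP eab]|/(_ (a, b))]; last by rewrite /= ab eqxx.
have : a \in [set a'; b'] by rewrite -eab !inE eqxx.
have : b \in [set a'; b'] by rewrite -eab !inE eqxx orbT.
rewrite !inE => /orP[]/eqP eb /orP[]/eqP ea; rewrite ?ea ?eb // in ab *.
- by rewrite eqxx in ab.
- by rewrite eqxx in ab.
Qed.

Lemma cards3P (T : finType) (e : {set T}) : #|e| = 3 ->
  exists a b c, [/\ uniq [:: a; b; c] & e = [set a; b; c]].
Proof.
move=> e3; have : size (enum e) = 3 by rewrite -cardE.
have ue := enum_uniq e; have me := mem_enum e.
case: (enum e) ue me => [|a [|b [|c [|]]]] // ue me _; exists a, b, c; split=> //.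
by apply/setP => x; rewrite -me !inE orbA.
Qed.

(** * Sparse systems of blocks *)

Section Blocks.

Variables (n k m Delta : nat).

Definition block := ({set 'I_n} * 'I_k)%type.

Implicit Types (F : {set block}) (B : {set 'I_n}).

Definition pair_degree F (u v : 'I_n) : nat :=
  #|[set b in F | (u \in b.1) && (v \in b.1)]|.

(* If adding a block B to F completes a clique A with #|A| > #|B|, then A has three
   vertices a, b, c in B and a vertex x outside B, so that (a, b, c) is bad; the
   case x = a forbids sharing a triple with a block of F. *)
Definition bad_triples F : {set 'I_n * 'I_n * 'I_n} :=
  [set u | [exists x, [&& x != u.1.2,
     [exists b in F, [&& u.1.1 \in b.1, u.1.2 \in b.1 & x \in b.1]] &
     [exists b in F, [&& u.1.2 \in b.1, u.2 \in b.1 & x \in b.1]]]]].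

Definition bad_pairs F : {set 'I_n * 'I_n} :=
  [set u | (u.1 != u.2) && (Delta <= pair_degree F u.1 u.2)].

(** The second clause makes the colour of a triple well defined, the third keeps [bad_triples]
    small, and the fourth excludes cliques on [m.+1] vertices even when colours are ignored. *)
Definition sparse F : Prop :=
  [/\ forall b, b \in F -> #|b.1| = m,
      forall b b' (e : {set 'I_n}), b \in F -> b' \in F ->
        e \subset b.1 -> e \subset b'.1 -> #|e| = 3 -> b = b',
      forall u v, u != v -> pair_degree F u v <= Delta &
      forall A : {set 'I_n}, #|A| = m.+1 -> exists e : {set 'I_n},
        [/\ e \subset A, #|e| = 3 & forall b, b \in F -> ~~ (e \subset b.1)]].

Definition admissible F (B : {set 'I_n}) : bool :=
  [forall a in B, forall b in B, forall c in B,
     uniq [:: a; b; c] ==> ((a, b, c) \notin bad_triples F)] &&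
  [forall a in B, forall b in B, (a, b) \notin bad_pairs F].

Lemma admissibleP F B : reflect
  ((forall a b c, a \in B -> b \in B -> c \in B -> uniq [:: a; b; c] ->
      (a, b, c) \notin bad_triples F) /\
   (forall a b, a \in B -> b \in B -> (a, b) \notin bad_pairs F))
  (admissible F B).
Proof.
apply: (iffP andP) => -[H3 H2]; split.
- move=> a b c Ba Bb Bc u; move/forall_inP/(_ a Ba): H3.
  by move/forall_inP/(_ b Bb)/forall_inP/(_ c Bc)/implyP/(_ u).
- by move=> a b Ba Bb; move/forall_inP/(_ a Ba)/forall_inP/(_ b Bb): H2.
- apply/forall_inP => a Ba; apply/forall_inP => b Bb; apply/forall_inP => c Bc.
  by apply/implyP => u; apply: H3.
- by apply/forall_inP => a Ba; apply/forall_inP => b Bb; apply: H2.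
Qed.

Lemma bad_triplesP F x a b c (b1 b2 : block) : x != b ->
  b1 \in F -> a \in b1.1 -> b \in b1.1 -> x \in b1.1 ->
  b2 \in F -> b \in b2.1 -> c \in b2.1 -> x \in b2.1 -> (a, b, c) \in bad_triples F.
Proof.
move=> xb F1 a1 bb1 x1 F2 b2b c2 x2; rewrite inE; apply/existsP; exists x.
by rewrite xb /=; apply/andP; split; apply/exists_inP;
  [exists b1; rewrite ?a1 ?bb1 | exists b2; rewrite ?b2b ?c2].
Qed.

Lemma sparse_add F B i : 2 < m -> sparse F -> #|B| = m -> admissible F B ->
  sparse ((B, i) |: F).
Proof.
move=> m3 [Fm F2 Fd FA] Bm /admissibleP[B3 B2].
have noshare b (e : {set 'I_n}) : b \in F -> e \subset B -> e \subset b.1 ->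
  #|e| = 3 -> False.
  move=> Fb eB eb e3; have [x [y [z [u def_e]]]] := cards3P e3.
  have /and3P[/norP[xy _] _ _] : [&& x \notin [:: y; z], y \notin [:: z] & true] by [].
  have [ex ey ez] : [/\ x \in e, y \in e & z \in e].
    by rewrite def_e !inE !eqxx !orbT.
  have /negP[] := B3 x y z (subsetP eB x ex) (subsetP eB y ey) (subsetP eB z ez) u.
  by apply: (@bad_triplesP F x x y z b b); rewrite ?(subsetP eb).
split.
- by move=> b /setU1P[->|/Fm].
- move=> b b' e /setU1P[->|Fb] /setU1P[->|Fb'] //=; last exact: F2.
    by move=> eB eb' e3; case: (noshare b' e).
  by move=> eb eB e3; case: (noshare b e).
- move=> u v uv; rewrite /pair_degree.
  have [/andP[Bu Bv]|nBuv] := boolP ((u \in B) && (v \in B)).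
    have := B2 u v Bu Bv; rewrite inE uv /= -ltnNge => ltD; apply: leq_trans ltD.
    apply: (@leq_trans #|(B, i) |: [set b in F | (u \in b.1) && (v \in b.1)]|).
      apply: subset_leq_card; apply/subsetP => b; rewrite !inE.
      by case/andP => /orP[->//|-> ->]; rewrite orbT.
    by rewrite cardsU1 -add1n leq_add // leq_b1.
  apply: leq_trans (Fd u v uv); apply: subset_leq_card; apply/subsetP => b.
  by rewrite !inE => /andP[/predU1P[->|-> //]] /=; rewrite (negPf nBuv).
- move=> A cardA; have [e [eA e3 eF]] := FA A cardA.
  have [eB|neB] := boolP (e \subset B); last first.
    by exists e; split=> // b /setU1P[->|/eF].
  have [x Ax Bx] : exists2 x, x \in A & x \notin B.
    have /subsetPn : ~~ (A \subset B).
      by apply/negP => /subset_leq_card; rewrite cardA Bm ltnn.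
    by case=> x; exists x.
  have [a [b [c [u def_e]]]] := cards3P e3.
  have [ea eb ec] : [/\ a \in e, b \in e & c \in e] by rewrite def_e !inE !eqxx !orbT.
  have Bin y : y \in e -> y \in B := subsetP eB y.
  have xe y : y \in e -> x != y by move=> /Bin; apply: contraTneq => <-.
  have /andP[/andP[ab ac] bc] : (a != b) && (a != c) && (b != c).
    by case/and3P: u; rewrite !inE negb_or => -> ->.
  (* A triple of [x] and two vertices of [e] that is in no old block witnesses the last clause,
     since [B] misses [x]. Otherwise two such triples yield a bad triple. *)
  have cand y z : y \in e -> z \in e -> y != z ->
      (exists e' : {set 'I_n}, [/\ e' \subset A, #|e'| = 3
        & forall b, b \in (B, i) |: F -> ~~ (e' \subset b.1)]) \/
      exists2 b, b \in F & [/\ x \in b.1, y \in b.1 & z \in b.1].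
    move=> ey ez yz; pose e' := [set x; y; z].
    have e'A : e' \subset A by rewrite !subUset !sub1set Ax !(subsetP eA).
    have e'3 : #|e'| = 3.
      by rewrite /e' setUC cardsU1 cards2 !inE negb_or eq_sym xe // eq_sym yz xe.
    have [/exists_inP[b0 Fb0 e'b0]|/exists_inPn noF] :=
      boolP [exists b0 in F, e' \subset b0.1].
      right; exists b0 => //; split; apply: (subsetP e'b0); rewrite !inE eqxx ?orbT //.
    left; exists e'; split=> // b0 /setU1P[->|/noF//] /=.
    by apply: contra Bx => /subsetP-> //; rewrite !inE eqxx.
  have [//|[b1 F1 [x1 a1 bb1]]] := cand a b ea eb ab.
  have [//|[b2 F2' [x2 b2b c2]]] := cand b c eb ec bc.
  have /negP[] := B3 a b c (Bin a ea) (Bin b eb) (Bin c ec) u.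
  exact: (bad_triplesP (xe b eb) F1 a1 bb1 x1 F2' b2b c2 x2).
Qed.

(** Choose [b1], then [a], [b], [x] in it, then one of at most [Delta] blocks through [b] and [x],
    then [c] in that block; the degree bound applies because [x != b]. *)
Lemma card_bad_triples F : sparse F -> #|bad_triples F| <= #|F| * m ^ 4 * Delta.
Proof.
move=> [Fm _ Fd _].
pose U := \bigcup_(b1 in F) \bigcup_(a in b1.1) \bigcup_(b in b1.1)
  \bigcup_(x in b1.1 | x != b)
  \bigcup_(b2 in [set b2 in F | (b \in b2.1) && (x \in b2.1)]) [set (a, b, c)
    | c in b2.1].
apply: (@leq_trans #|U|).
  apply: subset_leq_card; apply/subsetP => -[[a b] c]; rewrite inE.
  case/existsP => x /and3P[/= xb /exists_inP[b1 F1 /and3P[a1 bb1 x1]]].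
  case/exists_inP=> b2 F2 /and3P[b2b c2 x2].
  apply/bigcupP; exists b1 => //; apply/bigcupP; exists a => //; apply/bigcupP;
    exists b => //.
  apply/bigcupP; exists x; rewrite ?x1 //; apply/bigcupP.
  by exists b2; rewrite ?inE ?F2 ?b2b //; apply/imsetP; exists c.
rewrite (_ : #|F| * m ^ 4 * Delta = #|F| * (m * (m * (m * (Delta * m))))); last by lia.
apply: leq_trans (card_bigcup_le _ _) _; apply: leq_sum_const => b1 F1.
rewrite -{1}(Fm b1 F1).
apply: leq_trans (card_bigcup_le _ _) _; apply: leq_sum_const => a a1.
rewrite -{1}(Fm b1 F1).
apply: leq_trans (card_bigcup_le _ _) _; apply: leq_sum_const => b bb1.
apply: (@leq_trans (#|[pred x | (x \in b1.1) && (x != b)]| * (Delta * m))); last first.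
  rewrite leq_mul2r -(Fm b1 F1); apply/orP; right; apply: subset_leq_card.
  by apply/subsetP => x; rewrite !inE => /andP[].
apply: leq_trans (card_bigcup_le _ _) _; apply: leq_sum_const => x /andP[x1 xb].
apply: leq_trans (card_bigcup_le _ _) _.
apply: (@leq_trans (pair_degree F b x * m));
  last by rewrite leq_mul2r Fd ?orbT // eq_sym.
apply: leq_sum_const => b2; rewrite inE => /andP[F2 _].
by apply: leq_trans (leq_imset_card _ _) _; rewrite Fm.
Qed.

Lemma card_bad_pairs F : sparse F -> #|bad_pairs F| * Delta <= #|F| * m ^ 2.
Proof.
move=> [Fm _ _ _].
apply: (@leq_trans (\sum_(u in bad_pairs F) pair_degree F u.1 u.2)).
  by rewrite -sum_nat_const; apply: leq_sum => u; rewrite inE => /andP[].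
apply: (@leq_trans (\sum_u pair_degree F u.1 u.2)).
  by rewrite [leqRHS](bigID (mem (bad_pairs F))) leq_addr.
rewrite /pair_degree; under eq_bigr do rewrite -sum1_card.
under eq_bigr => u _.
  rewrite (eq_bigl (fun b => (b \in F) && ((u.1 \in b.1) && (u.2 \in b.1))));
    last first.
    by move=> b; rewrite inE.
  rewrite big_mkcondr.
over.
rewrite exchange_big /=; apply: leq_sum_const => b Fb.
rewrite -big_mkcond /= sum1dep_card -(Fm b Fb) -mulnn -cardsX; apply: subset_leq_card.
by apply/subsetP => -[u v]; rewrite !inE.
Qed.

End Blocks.

(** * Greedy choice of the blocks *)

Section Greedy.

Variables (n k m R : nat).

(** An index map and a colour can be chosen in [k * R ^ m] ways, and each colouring is hit by at
    least [n ^ R / 4] allowed choices, so some block hits a share [1 / (2 * A)] of the unhit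
    colourings; [steps] repetitions exhaust them. *)
Let A := 2 * k * R ^ m.
Let Delta := 8 * A ^ 2 * k * m ^ 4.
Let steps := 2 * A * k * n ^ 2.

Hypotheses (m_gt2 : 2 < m) (k_gt0 : 0 < k) (R_large : ramsey_bound k 1 (k * m) <= R)
  (n_large : 64 * A ^ 4 * k ^ 2 * m ^ 11 <= n) (n_large' : 2 * R ^ 2 <= n) (n_gt0 : 0
    < n)
  (R_gt0 : 0 < R).

(** Two stages: [R] points, then [m] of them and a colour. Ramsey's theorem inside the [R] points
    ensures that some second choice hits a given colouring. *)
Definition choice_type := ({ffun 'I_R -> 'I_n} * ({ffun 'I_m -> 'I_R} * 'I_k))%type.

Definition choice_block (x : choice_type) : block n k :=
  ([set x.1 (x.2.1 j) | j : 'I_m], x.2.2).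

Definition choice_ok (F : {set block n k}) (x : choice_type) : bool :=
  [&& injectiveb x.1, injectiveb x.2.1 & admissible Delta F (choice_block x).1].

Definition hits (d : {ffun 'I_n * 'I_n -> 'I_k}) (b : block n k) : bool :=
  [forall u in b.1, forall v in b.1, (u != v) ==> (d (u, v) == b.2)].

Lemma hitsP (d : {ffun 'I_n * 'I_n -> 'I_k}) (b : block n k) :
  reflect {in b.1 &, forall u v, u != v -> d (u, v) = b.2} (hits d b).
Proof.
apply: (iffP idP) => [H u v bu bv uv|H].
  by move/forall_inP/(_ u bu)/forall_inP/(_ v bv)/implyP/(_ uv)/eqP: H.
apply/forall_inP => u bu; apply/forall_inP => v bv; apply/implyP => uv.
by apply/eqP; apply: H.
Qed.

Let A_gt0 : 0 < A. Proof. by rewrite !muln_gt0 k_gt0 expn_gt0 R_gt0. Qed.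

(** Union bound over triples and over pairs of indices; each of the two sums is at most
    [n ^ R / (4 * A)]. *)
Lemma card_not_admissible_fixed (F : {set block n k}) (s : {ffun 'I_m -> 'I_R}) :
  sparse m Delta F -> #|F| <= steps -> injective s ->
  2 * A * #|[set g : {ffun 'I_R -> 'I_n} |
              ~~ admissible Delta F [set g (s j) | j : 'I_m]]| <= n ^ R.
Proof.
move=> spF cardF sI; set S := [set g | _].
pose S3 (j : 'I_m * 'I_m * 'I_m) := [set g : {ffun 'I_R -> 'I_n} |
  (g (s j.1.1), g (s j.1.2), g (s j.2)) \in bad_triples F].
pose S2 (j : 'I_m * 'I_m) := [set g : {ffun 'I_R -> 'I_n} |
  (g (s j.1), g (s j.2)) \in bad_pairs Delta F].
pose G3 := #|bad_triples F|; pose G2 := #|bad_pairs Delta F|.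
have sub : S \subset (\bigcup_(j | uniq [:: j.1.1; j.1.2; j.2]) S3 j) :|:
                     \bigcup_(j | j.1 != j.2) S2 j.
  apply/subsetP => g; rewrite [g \in S]inE; apply: contraNT.
  rewrite in_setU negb_or => /andP[/bigcupP no3 /bigcupP no2].
  apply/admissibleP; split.
    move=> _ _ _ /imsetP[j1 _ ->] /imsetP[j2 _ ->] /imsetP[j3 _ ->] u.
    apply/negP => bad; apply: no3; exists (j1, j2, j3); last by rewrite inE.
    exact: (@map_uniq _ _ (g \o s) [:: j1; j2; j3] u).
  move=> _ _ /imsetP[j1 _ ->] /imsetP[j2 _ ->].
  apply/negP => bad; apply: no2; exists (j1, j2); last by rewrite inE.
  by apply: contraTneq bad => /= ->; rewrite inE eqxx.
have card_S : #|S| <= \sum_(j | uniq [:: j.1.1; j.1.2;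
  j.2]) #|S3 j| + \sum_(j | j.1 != j.2) #|S2 j|.
  apply: leq_trans (subset_leq_card sub) _; apply: leq_trans (leq_card_setU _ _) _.
  by apply: leq_add; apply: card_bigcup_le.
have bound3 : (\sum_(j | uniq [:: j.1.1; j.1.2;
  j.2]) #|S3 j|) * n ^ 3 <= m ^ 3 * (G3 * n ^ R).
  rewrite big_distrl; apply: leq_trans (leq_sum_const (b := G3 * n ^ R) _) _.
    move=> [[j1 j2] j3] u; have := card_comp3 (bad_triples F) (p1 := s j1) (p2 :=
      s j2) (p3 := s j3).
    by rewrite !card_ord; apply; rewrite -(map_inj_uniq sI) in u.
  by rewrite leq_mul2r (leq_trans (max_card _)) ?orbT // !card_prod !card_ord -mulnA.
have bound2 : (\sum_(j | j.1 != j.2) #|S2 j|) * n ^ 2 <= m ^ 2 * (G2 * n ^ R).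
  rewrite big_distrl; apply: leq_trans (leq_sum_const (b := G2 * n ^ R) _) _.
    move=> [j1 j2] u; have := card_comp2 (bad_pairs Delta F) (p1 := s j1) (p2 := s j2).
    by rewrite !card_ord; apply; rewrite (inj_eq sI).
  by rewrite leq_mul2r (leq_trans (max_card _)) ?orbT // !card_prod !card_ord.
(* With the values of [steps] and [Delta] inserted, this is exactly [n_large] times [n ^ 2]. *)
have small3 : 4 * A * m ^ 3 * G3 <= n ^ 3.
  have := card_bad_triples spF; rewrite -/G3 => G3_le.
  apply: (@leq_trans (4 * A * m ^ 3 * (steps * m ^ 4 * Delta))).
    by apply: leq_mul => //; apply: leq_trans G3_le _; do 2![apply: leq_mul => //].
  apply: (@leq_trans (64 * A ^ 4 * k ^ 2 * m ^ 11 * n ^ 2));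
    first by rewrite /steps /Delta; lia.
  by rewrite [n ^ 3]expnS leq_mul2r n_large orbT.
have small2 : 4 * A * m ^ 2 * G2 <= n ^ 2.
  have := card_bad_pairs spF; rewrite -/G2 => G2_le.
  (* [Delta] was chosen as this factor times [4 * A * m ^ 2]. *)
  have D0 : 0 < 2 * A * k * m ^ 2 by rewrite (muln_gt0 (2 * A * k)) (muln_gt0 (2 *
    A)) (muln_gt0 2 A) A_gt0 k_gt0 expn_gt0 (ltnW (ltnW m_gt2)).
  rewrite -(leq_pmul2l D0); apply: (@leq_trans (G2 * Delta));
    first by rewrite /Delta; lia.
  apply: leq_trans G2_le _; apply: (@leq_trans (steps * m ^ 2));
    first by rewrite leq_mul2r cardF orbT.
  by rewrite /steps; lia.
have n3 : 0 < n ^ 3 by rewrite expn_gt0 n_gt0.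
rewrite -(leq_pmul2l n3) -(@leq_pmul2l 2) //.
move: card_S bound3 bound2 small3 small2; set s3 := \sum_(_ | _) _;
  set s2 := \sum_(_ | _) _.
set X := n ^ R; rewrite (_ : n ^ 3 = n * n ^ 2) //.
set N2 := n ^ 2; set Q := #|S|; move: G3 G2 s3 s2 X Q N2 => G3 G2 s3 s2 X Q N2.
move=> h1 h2 h3 h4 h5.
apply: (@leq_trans (4 * A * (n * N2) * (s3 + s2))).
  by apply: leq_trans (leq_mul (leqnn (4 * A * (n * N2))) h1); lia.
rewrite (_ : _ * (s3 + s2) = 4 * A * (s3 * (n * N2) + n * (s2 * N2))); last by lia.
apply: (@leq_trans (4 * A * (m ^ 3 * (G3 * X) + n * (m ^ 2 * (G2 * X))))).
  by rewrite leq_mul2l leq_add ?orbT // leq_mul2l h3 orbT.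
apply: (@leq_trans (n * N2 * X + n * N2 * X)); last by lia.
rewrite mulnDr; apply: leq_add.
  by apply: leq_trans (leq_mul h4 (leqnn X)); lia.
by apply: leq_trans (leq_mul (leq_mul (leqnn n) h5) (leqnn X)); lia.
Qed.

Lemma card_not_admissible (F : {set block n k}) : sparse m Delta F -> #|F| <= steps ->
  4 * #|[set x : choice_type | injectiveb x.2.1 &&
          ~~ admissible Delta F (choice_block x).1]| <= n ^ R.
Proof.
move=> spF cardF; pose Bad (s : {ffun 'I_m -> 'I_R}) := [set g : {ffun 'I_R -> 'I_n} |
  ~~ admissible Delta F [set g (s j) | j : 'I_m]].
set S := [set x | _].
have sub : S \subset \bigcup_(s : {ffun 'I_m -> 'I_R} * 'I_k | injectiveb s.1)
                       [set (g, s) | g in Bad s.1].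
  apply/subsetP => -[g s]; rewrite inE => /andP[/= sI nadm].
  by apply/bigcupP; exists s => //; apply/imsetP; exists g; rewrite ?inE.
have card_S : #|S| * (2 * A) <= \sum_(s : {ffun 'I_m -> 'I_R} * 'I_k
  | injectiveb s.1) n ^ R.
  apply: leq_trans (leq_mul (leq_trans (subset_leq_card sub) (card_bigcup_le _ _))
    (leqnn _)) _.
  rewrite big_distrl /=; apply: leq_sum => s /injectiveP sI.
  apply: leq_trans (leq_mul (leq_imset_card _ _) (leqnn _)) _.
  by rewrite mulnC; apply: card_not_admissible_fixed.
have kR0 : 0 < k * R ^ m by rewrite muln_gt0 k_gt0 expn_gt0 R_gt0.
rewrite -(leq_pmul2l kR0).
have -> : k * R ^ m * (4 * #|S|) = #|S| * (2 * A) by rewrite /A; lia.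
apply: leq_trans card_S _; apply: leq_trans (leq_sum_const (b := n ^ R) _) _ => //.
rewrite leq_mul2r; apply/orP; right; apply: leq_trans (max_card _) _.
by rewrite card_prod card_ffun !card_ord mulnC.
Qed.

Lemma hits_injective (d : {ffun 'I_n * 'I_n -> 'I_k}) (g : {ffun 'I_R -> 'I_n}) :
  (forall u v, d (u, v) = d (v, u)) -> injective g ->
  exists2 s : {ffun 'I_m -> 'I_R} * 'I_k, injectiveb s.1 & hits d (choice_block (g, s)).
Proof.
move=> dC gI; have i0 : 'I_k by exists 0.
have [c cd] := symmetric_set_fun i0 (fun p q => dC (g p) (g q)).
have [|i [B [_ cardB cB]]] := @ramsey_sets 1 _ i0 (fun=> m) _ [set: 'I_R] c.
  by rewrite cardsT sum_nat_const !card_ord.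
pose s := [ffun j : 'I_m => enum_val (cast_ord (esym cardB) j)].
have sI : injective s by move=> j1 j2; rewrite !ffunE => /enum_val_inj/cast_ord_inj.
have sB j : s j \in B by rewrite ffunE; apply: enum_valP.
exists (s, i); first exact/injectiveP.
apply/hitsP => _ _ /imsetP[j1 _ ->] /imsetP[j2 _ ->] /= gs12.
have s12 : s j1 != s j2 by apply: contraNneq gs12 => ->.
by rewrite -cd // cB ?cards2 ?s12 // subUset !sub1set !sB.
Qed.

(** At most half of the maps [g] fail to be injective, every injective one admits a hitting choice,
    and at most [n ^ R / 4] choices are lost to inadmissible blocks. *)
Lemma card_hits (F : {set block n k}) (d : {ffun 'I_n * 'I_n -> 'I_k}) :
  sparse m Delta F -> #|F| <= steps -> (forall u v, d (u, v) = d (v, u)) ->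
  n ^ R <= 4 * #|[set x | choice_ok F x && hits d (choice_block x)]|.
Proof.
move=> spF cardF dC; have := card_not_admissible spF cardF.
set N := [set x | _ && ~~ _]; set H := [set x | _] => cardN.
pose G := [set g : {ffun 'I_R -> 'I_n} | injectiveb g].
have GS : #|G| <= #|H| + #|N|.
  apply: (@leq_trans #|H :|: N|); last exact: leq_card_setU.
  apply: (@leq_trans #|fst @: (H :|: N)|); last exact: leq_imset_card.
  apply: subset_leq_card; apply/subsetP => g; rewrite inE => gI.
  have [s sI hit] := hits_injective dC (injectiveP _ gI).
  apply/imsetP; exists (g, s) => //; rewrite in_setU inE [(g, s) \in N]inE /choice_ok.
  rewrite [(g, s).1]/= gI [(g, s).2]/= sI hit andbT /=.
  by case: (admissible _ _ _).
have := card_noninjective 'I_R 'I_n; rewrite !card_ord.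
have : #|G| + #|[set g : {ffun 'I_R -> 'I_n} | ~~ injectiveb g]| = n ^ R.
  rewrite -[in RHS](card_ord n) -[in RHS](card_ord R) -card_ffun -(cardsC G).
  by congr (_ + _); apply: eq_card => g; rewrite !inE.
set Z := #|[set g | ~~ _]| => eqG leZ.
have : 2 * Z <= n ^ R.
  rewrite -(leq_pmul2r n_gt0) -mulnA; apply: leq_trans (leq_mul (leqnn 2) leZ) _.
  by rewrite mulnA [X in _ <= X]mulnC; apply: leq_mul.
by lia.
Qed.

Definition unhit (F : {set block n k}) : {set {ffun 'I_n * 'I_n -> 'I_k}} :=
  [set d : {ffun 'I_n * 'I_n -> 'I_k}
    | [forall u, forall v, d (u, v) == d (v, u)] && [forall b in F, ~~ hits d b]].

(** Averaging: if every allowed block hit a smaller share, counting the pairs of a choice and an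
    unhit colouring in two ways would contradict [card_hits]. *)
Lemma greedy_step (F : {set block n k}) : sparse m Delta F -> #|F| <= steps ->
  exists F' : {set block n k}, [/\ sparse m Delta F', #|F'| <= #|F|.+1 &
    2 * A * #|unhit F'| <= (2 * A - 1) * #|unhit F|].
Proof.
move=> spF cardF; have [U0|U_gt0] := posnP #|unhit F|.
  by exists F; rewrite U0 !muln0.
pose Hx (x : choice_type) := [set d in unhit F | hits d (choice_block x)].
have [x okx Hxle] : exists2 x, choice_ok F x & #|unhit F| <= 2 * A * #|Hx x|.
  case: (pickP [pred x | choice_ok F x && (#|unhit F| <= 2 * A * #|Hx x|)]) =>
    [x /andP[]|none].
    by exists x.
  have lt_sum : 2 * A * \sum_(x | choice_ok F x) #|Hx x| <= k * R ^ m * n ^ R *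
    #|unhit F|.-1.
    rewrite big_distrr /=; apply: leq_trans (leq_sum_const (b := #|unhit F|.-1) _) _.
      move=> x okx; have := none x; rewrite /= okx /= => /negbT.
      by rewrite -ltnNge => lt; rewrite -ltnS prednK.
    rewrite leq_mul2r; apply/orP; right; apply: leq_trans (max_card _) _.
    by rewrite !card_prod !card_ffun !card_ord; lia.
  have ge_sum : n ^ R * #|unhit F| <= 4 * \sum_(x | choice_ok F x) #|Hx x|.
    rewrite (_ : \sum_(x | _) _ = \sum_(d in unhit F)
        #|[set x | choice_ok F x && hits d (choice_block x)]|); last first.
      under eq_bigr => x _.
        rewrite -sum1_card (eq_bigl (fun d =>
          (d \in unhit F) && hits d (choice_block x))).
          by rewrite big_mkcondr over.
        by move=> d; rewrite inE.
      rewrite exchange_big /=; apply: eq_bigr => d _.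
      by rewrite -big_mkcondr /= sum1dep_card.
    rewrite big_distrr /= mulnC -sum_nat_const; apply: leq_sum => d.
    rewrite inE => /andP[/forallP dC _]; apply: card_hits => // u v.
    by apply/eqP; have /forallP := dC u.
  have X0 : 0 < k * R ^ m * n ^ R by rewrite !muln_gt0 k_gt0 !expn_gt0 R_gt0 n_gt0.
  have : k * R ^ m * (n ^ R * #|unhit F|) <= k * R ^ m * n ^ R * #|unhit F|.-1.
    apply: leq_trans lt_sum; apply: leq_trans (leq_mul (leqnn _) ge_sum) _.
    by rewrite /A; lia.
  by rewrite mulnA leq_pmul2l // leqNgt prednK // leqnn.
have /and3P[gI sI adm] := okx; exists (choice_block x |: F); split.
- have -> : choice_block x = ([set x.1 (x.2.1 j) | j : 'I_m], x.2.2) by [].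
  apply: sparse_add => //; rewrite card_imset ?card_ord //.
  by move=> j1 j2 /(injectiveP _ gI)/(injectiveP _ sI).
- by rewrite cardsU1 -add1n leq_add2r leq_b1.
have : #|unhit (choice_block x |: F)| + #|Hx x| <= #|unhit F|.
  rewrite -(cardsID (Hx x) (unhit F)) addnC leq_add //; apply: subset_leq_card.
    by apply/subsetP => d; rewrite !inE => /andP[->].
  apply/subsetP => d; rewrite in_setD [d \in unhit _]inE.
  move=> /andP[dC /forall_inP dF]; rewrite !inE dC /=.
  rewrite (negPf (dF _ (setU11 _ _))) andbF /=.
  by apply/forall_inP => b Fb; apply: dF; rewrite inE Fb orbT.
move: Hxle A_gt0; set a := #|_|; set b := #|_|; set e := #|_|.
have := A_gt0; move: A a b e => A' a b e A0 h1 _ h2.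
have : 2 * A' * (e + b) <= 2 * A' * a by rewrite leq_mul2l h2 orbT.
by rewrite mulnBl mul1n; lia.
Qed.

Lemma greedy_iter (j : nat) : j <= steps -> exists F : {set block n k},
  [/\ sparse m Delta F, #|F| <= j
    & (2 * A) ^ j * #|unhit F| <= (2 * A - 1) ^ j * k ^ (n ^ 2)].
Proof.
elim: j => [|j IHj] lej.
  exists set0; split; rewrite ?cards0 // ?mul1n.
    split=> [b|b b' e|u v uv|B cardB]; rewrite ?inE //.
      by rewrite /pair_degree (eq_card0 (fun b => _)) // => b; rewrite !inE.
    have [|e eB e3] := @subset_of_card _ B 3; first by rewrite cardB ltnW.
    by exists e; split=> // b; rewrite inE.
  apply: leq_trans (max_card _) _.
  by rewrite card_ffun card_prod !card_ord mulnn.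
have [F [spF cardF leF]] := IHj (ltnW lej).
have [|F' [spF' cardF' leF']] := greedy_step spF;
  first exact: leq_trans cardF (ltnW lej).
exists F'; split=> //; first exact: leq_trans cardF' _.
rewrite [(2 * A) ^ _]expnS [(_ - 1) ^ _]expnS.
apply: (@leq_trans ((2 * A) ^ j * ((2 * A - 1) * #|unhit F|))).
  by rewrite [2 * A * _]mulnC -mulnA leq_mul2l leF' orbT.
by rewrite mulnCA -mulnA leq_mul2l leF orbT.
Qed.

(** Bernoulli's inequality [(1 + 1 / b) ^ j >= 1 + j / b] without denominators, taken at
    [j = b.+1]. *)
Lemma double_exp_le (b : nat) : 2 * b ^ b.+1 <= b.+1 ^ b.+1.
Proof.
suff bern j : (b + j) * b ^ j <= b.+1 ^ j * b.
  case: b bern => [//|b] bern; rewrite -(leq_pmul2r (ltn0Sn b)).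
  apply: leq_trans (bern b.+2); rewrite -mulnA mulnCA mulnC.
  by rewrite leq_mul2r; apply/orP; right; lia.
elim: j => [|j IHj]; first by rewrite addn0 muln1 mul1n.
apply: (@leq_trans (b.+1 * ((b + j) * b ^ j))).
  by rewrite expnS; nia.
by rewrite [b.+1 ^ j.+1]expnS -mulnA leq_mul2l IHj orbT.
Qed.

(** Every [2 * A] steps halve the bound on the unhit colourings, so in the end at most
    [k ^ (n ^ 2) / 2 ^ (k * n ^ 2)] remain, fewer than one because [k < 2 ^ k]. *)
Lemma sparse_hitting_family : exists2 F : {set block n k}, sparse m Delta F
  & unhit F = set0.
Proof.
have [F [spF _ leF]] := greedy_iter (leqnn steps); exists F => //.
apply/eqP; rewrite -cards_eq0 -leqn0 leqNgt; apply/negP => U_gt0.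
have : (2 * A) ^ steps <= (2 * A - 1) ^ steps * k ^ (n ^ 2).
  by apply: leq_trans leF; rewrite leq_pmulr.
apply/negP; rewrite -ltnNge; set b := 2 * A - 1.
have eA : 2 * A = b.+1 by rewrite /b; have := A_gt0; lia.
have b0 : 0 < b by rewrite /b; have := A_gt0; lia.
have -> : steps = b.+1 * (k * n ^ 2) by rewrite /steps eA -!mulnA.
rewrite eA (expnM b.+1 b.+1) (expnM b b.+1).
apply: (@leq_trans ((2 * b ^ b.+1) ^ (k * n ^ 2))); last first.
  by rewrite leq_exp2r ?double_exp_le // muln_gt0 k_gt0 expn_gt0 n_gt0.
rewrite expnMn mulnC ltn_pmul2r ?expn_gt0 ?b0 // expnM.
by rewrite ltn_exp2r ?expn_gt0 ?n_gt0 // ltn_expl.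
Qed.

End Greedy.

(** [R] comes from [k.+1 <= k ^ 2]. With [64 <= k ^ 6] and [m <= k ^ m] the second bound needs the
    exponent [8 * k * m ^ 2 + 11 * m + 16], which [10 * k * m.+1 ^ 4] dominates. *)
Lemma pattern_bounds (k m : nat) : 1 < k -> 2 < m ->
  let n := k ^ (10 * k * m.+1 ^ 4) in let R := k ^ (2 * k * m) in
  [/\ ramsey_bound k 1 (k * m) <= R,
      64 * (2 * k * R ^ m) ^ 4 * k ^ 2 * m ^ 11 <= n & 2 * R ^ 2 <= n].
Proof.
move=> k_gt1 m_gt2 n R.
have le2k a : 2 ^ a <= k ^ a by case: a => // a; rewrite leq_exp2r.
have mk : m <= k ^ m by apply/ltnW/ltn_expl.
have k0 : 0 < k by apply: ltnW.
split.
- apply: leq_trans (ramsey_bound2_le _ _) _; rewrite /R -mulnA.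
  rewrite (expnM k 2) leq_exp2r ?muln_gt0 ?k0 ?(ltnW (ltnW m_gt2)) //.
  by rewrite -mulnn; nia.
- apply: (@leq_trans (k ^ 6 * (k * k * R ^ m) ^ 4 * k ^ 2 * (k ^ m) ^ 11)).
    apply: leq_mul; last by rewrite leq_exp2r.
    rewrite leq_mul2r; apply/orP; right; apply: leq_mul; first exact: (le2k 6).
    by rewrite leq_exp2r // leq_mul2r leq_mul2r k_gt1 !orbT.
  rewrite /n /R mulnn !expnMn -!expnM -!expnD leq_exp2l //.
  apply: (@leq_trans (10 * k * (m.+1 ^ 2 * 16))); first by nia.
  by rewrite (_ : m.+1 ^ 4 = m.+1 ^ 2 * m.+1 ^ 2) ?leq_mul2l ?leq_sqr ?(leq_exp2r 4)
    ?orbT //; lia.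
- apply: (@leq_trans (k * R ^ 2)); first by rewrite leq_mul2r k_gt1 orbT.
  rewrite /n /R -expnM -expnS leq_exp2l //.
  by nia.
Qed.

(** A triple gets the colour of the only block containing it. Blocks have size [m = t.-1], so the
    last clause of [sparse] speaks of [t]-sets. *)
Theorem hitting_pattern (t k : nat) : 3 < t -> 1 < k ->
  exists col : {set 'I_(k ^ (10 * k * t ^ 4))} -> option 'I_k,
  [/\ triple_coloring col, clique_free t col &
  forall d : 'I_(k ^ (10 * k * t ^ 4)) -> 'I_(k ^ (10 * k * t ^ 4)) -> 'I_k,
    (forall u v, d u v = d v u) ->
    exists i (B : {set 'I_(k ^ (10 * k * t ^ 4))}),
      [/\ #|B| = t.-1, {in B &, forall u v, u != v ->
        d u v = i} & mono_clique col B i]].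
Proof.
case: t => // m m_gt2 k_gt1; rewrite ltnS in m_gt2.
have [] := pattern_bounds k_gt1 m_gt2; have k_gt0 := ltnW k_gt1.
have : 0 < k ^ (10 * k * m.+1 ^ 4) by rewrite expn_gt0 k_gt0.
have : 0 < k ^ (2 * k * m) by rewrite expn_gt0 k_gt0.
move: (k ^ (10 * _ * _)) (k ^ (2 * _ * _)) => n R R_gt0 n_gt0 R_large n_large n_large'.
have [F [Fm F2 _ FA] hitF] := sparse_hitting_family m_gt2 k_gt0 R_large n_large
  n_large' n_gt0 R_gt0.
pose col (e : {set 'I_n}) : option 'I_k :=
  if #|e| == 3 then
    if [pick b | (b \in F) && (e \subset b.1)] is Some b then Some b.2 else None
  else None.
exists col; split.
- by move=> e i; rewrite /col; case: eqP.
- move=> A i /FA[e [eA e3 eF]] /(_ e eA e3); rewrite /col e3 eqxx.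
  by case: pickP => // b /andP[/eF/negP].
- move=> d dC; have := in_set0 [ffun u : 'I_n * 'I_n => d u.1 u.2]; rewrite -hitF inE.
  rewrite (introT forallP) /=; last first.
    by move=> u; apply/forallP => v; rewrite !ffunE /= dC.
  move=> /negbT; rewrite negb_forall_in => /exists_inP[b Fb /negbNE/hitsP hit].
  exists b.2, b.1; split; first exact: Fm.
    by move=> u v bu bv uv; rewrite -(hit u v bu bv uv) ffunE.
  move=> e eb e3; rewrite /col e3 eqxx; case: pickP => [b' /andP[Fb' eb']|/(_ b)].
    by rewrite (F2 b b' e Fb Fb' eb eb' e3).
  by rewrite Fb eb.
Qed.

(** * The low degree hypergraph *)

(** For [i = j] the system is empty, so that all pairs of colours may serve as indices. *)
Definition two_coloring (X : finType) (k : nat) (S : {set X}) (x0 : X) (i j : 'I_k)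
    (e : {set X}) : option 'I_k :=
  if (#|e| == 3) && (e \subset S)
    && (i != j) then Some (if x0 \in e then i else j) else None.

(** Only [S] itself could be a clique, and as [t > 3] it contains triples through [x0] and triples
    avoiding it. *)
Lemma two_coloring_clique_free (X : finType) (k t : nat) (S : {set X}) (x0 : X) (i j
  : 'I_k) :
  3 < t -> #|S| = t -> x0 \in S -> clique_free t (two_coloring S x0 i j).
Proof.
move=> t_gt3 cardS Sx0 A l cardA mono.
have edge (e : {set X}) : e \subset A -> #|e| = 3 ->
    [/\ e \subset S, i != j & l = if x0 \in e then i else j].
  by move=> eA e3; have := mono e eA e3; rewrite /two_coloring;
    case: ifP => // /andP[/andP[_ ->]] -> [->].
have AS : A = S.
  apply/eqP; rewrite eqEcard cardS cardA leqnn andbT; apply/subsetP => x Ax.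
  have [||e [xe eA e3]] := @subset_between _ A [set x] 3;
    rewrite ?sub1set ?cards1 ?cardA ?(ltnW t_gt3) //.
  by have [/subsetP-> //] := edge e eA e3; rewrite -sub1set.
have [||e [x0e eA e3]] := @subset_between _ A [set x0] 3;
  rewrite ?sub1set ?cards1 ?cardA ?(ltnW t_gt3) ?AS //.
have [|e' eA' e'3] := @subset_of_card _ (A :\ x0) 3.
  by move: t_gt3; rewrite AS -cardS (cardsD1 x0 S) Sx0 add1n ltnS.
have [_ ij] := edge e eA e3; rewrite -sub1set x0e => l_i; have [|//|_ _ l_j] := edge e'.
  by apply: subset_trans eA' (subsetDl _ _).
have x0e' : x0 \notin e' by apply/negP => /(subsetP eA'); rewrite !inE eqxx.
by move: ij; rewrite -l_i (negPf x0e') in l_j *; rewrite -l_j eqxx.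
Qed.

Lemma subset_imset_preim (X Y : finType) (f : X -> Y) (A : {set X}) (e : {set Y}) :
  injective f -> e \subset f @: A -> exists e0 : {set X},
  [/\ e0 \subset A, e = f @: e0 & #|e0| = #|e|].
Proof.
move=> fI eA; have def_e : f @: (f @^-1: e) = e.
  apply/setP => x; apply/imsetP/idP => [[y]|ex]; first by rewrite inE => ey ->.
  by have /imsetP[y _ def_x] := subsetP eA x ex; exists y; rewrite ?inE -?def_x.
exists (f @^-1: e); split=> //; last by rewrite -[in RHS]def_e card_imset.
by apply/subsetP => x; rewrite inE => /(subsetP eA)/imsetP[y Ay /fI->].
Qed.

Lemma mono_copy_completeP (r t k : nat) (T : finType) (c : {set T} -> 'I_k)
    (H : hypergraph r T) :
  monochromatic_copy c H (complete r t) <->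
  exists (A : {set T}) (i : 'I_k), [/\ #|A| = t, A \subset verts H &
    forall e : {set T}, e \subset A -> #|e| = r -> e \in edges H /\ c e = i].
Proof.
split=> [[f [i [fI fV fE]]]|[A [i [cardA AV AE]]]].
  have {}fI : injective f by move=> x y; apply: fI; rewrite inE.
  exists (f @: [set: 'I_t]), i; split=> //.
    by rewrite card_imset // cardsT card_ord.
  move=> e /(subset_imset_preim fI)[e0 [_ def_e e0r]] er; rewrite def_e.
  by apply: fE; rewrite inE e0r er.
pose f (j : 'I_t) := enum_val (cast_ord (esym cardA) j).
have fI : injective f by move=> j1 j2 /enum_val_inj/cast_ord_inj.
have fA j : f j \in A by apply: enum_valP.
exists f, i; split; first by move=> x y _ _; apply: fI.
  by apply: subset_trans AV; apply/subsetP => _ /imsetP[j _ ->].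
move=> e; rewrite inE => /eqP er; apply: AE; last by rewrite card_imset.
by apply/subsetP => _ /imsetP[j _ ->].
Qed.

Lemma ramsey_minimal (r k : nat) (T U : finType) (H : hypergraph r T) (F : hypergraph
  r U) :
  ramsey k H F -> exists2 G : hypergraph r T, subhypergraph G H & minimal_ramsey k G F.
Proof.
have [n] := ubnP (#|verts H| + #|edges H|); elim: n H => // n IHn H leHn HF.
have [[G GH GF]|noG] := pselect (exists2 G : hypergraph r T,
  proper_subhypergraph G H & ramsey k G F).
  have /andP[/andP[GHv GHe] nHG] := GH; have [|G' G'G minG'] := IHn G _ GF; last first.
    exists G' => //; have /andP[G'v G'e] := G'G.
    by rewrite /subhypergraph (subset_trans G'v) // (subset_trans G'e).
  rewrite -ltnS; apply: leq_trans leHn; rewrite ltnS.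
  rewrite ltn_neqAle leq_add ?subset_leq_card // andbT.
  apply: contra nHG.
  have [_ ->] := leqif_add (subset_leqif_cards GHv) (subset_leqif_cards GHe).
  by move/andP => [/eqP vGH /eqP eGH]; rewrite /subhypergraph vGH eGH !subxx.
exists H; first by rewrite /subhypergraph !subxx.
by split=> // G GH GF; apply: noG; exists G.
Qed.

Lemma leq_min_degree (r : nat) (T : finType) (H : hypergraph r T) (v : T) :
  v \in verts H -> min_degree H <= degree H v.
Proof.
move=> Hv; rewrite /min_degree; have := mem_index_enum v.
elim: (index_enum T) => [//|w s IHs]; rewrite inE big_cons => /predU1P[<-|vs].
  by rewrite Hv geq_minl.
have {}IHs := IHs vs; case: (w \in verts H) => //.
by apply: leq_trans (geq_minr _ _) IHs.
Qed.

Lemma min_degree_geq (r : nat) (T : finType) (H : hypergraph r T) (b : nat) :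
  (exists v, v \in verts H) -> (forall v, v \in verts H -> b <= degree H v) ->
  b <= min_degree H.
Proof.
move=> [v0 Hv0] deg; rewrite /min_degree; elim/big_ind: _ => //.
  apply: leq_trans (deg v0 Hv0) _; apply: subset_leq_card.
  by apply/subsetP => e; rewrite inE => /andP[].
by move=> x y bx byy; rewrite leq_min bx.
Qed.

Lemma exists_least (P : nat -> Prop) (n : nat) : P n ->
  exists2 m, is_least P m & m <= n.
Proof.
elim/ltn_ind: n => n IHn Pn.
have [[m ltmn Pm]|nom] := pselect (exists2 m, m < n & P m).
  by have [m' leastm' lem'] := IHn m ltmn Pm; exists m' => //;
    apply: leq_trans lem' (ltnW ltmn).
exists n => //; split=> // m Pm; rewrite leqNgt; apply/negP => ltmn.
by apply: nom; exists m.
Qed.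

Section UpperBound.

Variables (t k : nat).
Hypotheses (t_gt3 : 3 < t) (k_gt1 : 1 < k).

Let n := k ^ (10 * k * t ^ 4).

(* Either chi has a monochromatic clique, or a copy of the pattern keeps its
   colours up to a permutation: two colour classes of V receiving the same
   colour would make one of the two-coloured cliques monochromatic. *)
Lemma arrow_pattern : exists (V : finType) (cV : {set V} -> option 'I_k),
  [/\ triple_coloring cV, clique_free t cV &
  forall chi : {set V} -> 'I_k,
    (exists (A : {set V}) i, #|A| = t /\
       forall e : {set V}, e \subset A -> #|e| = 3 -> cV e != None /\ chi e = i) \/
    exists2 w : {ffun 'I_n -> V}, injective w &
      forall d : 'I_n -> 'I_n -> 'I_k, (forall u v, d u v = d v u) ->
      exists i (B : {set 'I_n}), [/\ #|B| = t.-1,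
        {in B &, forall u v, u != v -> d u v = i} &
        forall e : {set 'I_n}, e \subset B -> #|e| = 3 ->
          cV (w @: e) != None /\ chi (w @: e) = i]].
Proof.
have [col [col3 colf hit]] := hitting_pattern t_gt3 k_gt1;
  rewrite -/n in col col3 colf hit.
(* The components of the disjoint union share one vertex type, so the two-coloured cliques are
   placed on [t] of the vertices of the pattern. *)
have [|S _ cardS] := @subset_of_card _ [set: 'I_n] t.
  rewrite cardsT card_ord; apply: leq_trans (ltnW (ltn_expl t k_gt1)) _.
  by rewrite leq_exp2l // expnS mulnCA leq_pmulr // !muln_gt0 ?expn_gt0 (ltnW k_gt1)
    !(leq_trans _ t_gt3).
have [x0 Sx0] : exists x0, x0 \in S by apply/card_gt0P;
  rewrite cardS (leq_trans _ t_gt3).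
pose cs (s : option ('I_k * 'I_k)) (e : {set 'I_n}) :=
  if s is Some ij then two_coloring S x0 ij.1 ij.2 e else col e.
have cs3 s : triple_coloring (cs s).
  case: s => [ij|] e l; last exact: col3.
  by rewrite /= /two_coloring; case: ifP => // /andP[/andP[/eqP e3 _] _] _.
have csf s : clique_free t (cs s).
  by case: s => [ij|] //; apply: two_coloring_clique_free.
have [V [cV [cV3 cVf arrow]]] := all_colors_arrow t_gt3 (ltnW k_gt1)
  (union_triple cs3) (union_clique_free (ltnW t_gt3) csf).
exists V, cV; split=> // chi; have [f [fI fc] [pi fpi]] := arrow chi.
have cs_union s (e : {set 'I_n}) l : cs s e = Some l ->
    cV ((f \o pair s) @: e) = Some l /\ chi ((f \o pair s) @: e) = pi l.
  move=> ce; have : union_coloring cs (pair s @: e) = Some l.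
    by rewrite union_coloring_pair // -card_gt0 (cs3 _ _ _ ce).
  by move=> ue; rewrite imset_comp; split; [apply: fc | apply: fpi].
have fsI s : injective (f \o pair s) by apply: inj_comp fI (@pair_inj _ _ s).
have [/injectiveP piI|/injectivePn[i [j ij pi_ij]]] := boolP (injectiveb pi);
  last first.
  left; pose s := Some (i, j); exists ((f \o pair s) @: S), (pi i).
  split; first by rewrite card_imset.
  move=> e /(subset_imset_preim (fsI s))[e0 [e0S def_e e03]] e3; rewrite e3 in e03.
  have [|cVe chie] := cs_union s e0 (if x0 \in e0 then i else j).
    by rewrite /= /two_coloring e03 e0S ij.
  by rewrite def_e cVe chie; split=> //; case: ifP.
right; pose w := [ffun x => (f \o pair None) x].
have wE (e : {set 'I_n}) : w @: e = (f \o pair None) @: e by apply: eq_imset => x;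
  rewrite ffunE.
exists w; first by move=> x y; rewrite !ffunE; apply: fsI.
(* Where the pattern has colour [i], [chi] shows [pi i]; hence [d] is composed with the inverse of
   [pi] before the pattern is applied. *)
move=> d dC; have [|i [B [cardB dB colB]]] := hit (fun u v => invF piI (d u v)).
  by move=> u v; rewrite dC.
exists (pi i), B; split=> // [u v Bu Bv uv|e eB e3].
  by rewrite -(dB u v Bu Bv uv) f_invF.
have [cVe chie] := cs_union None e i (colB e eB e3).
by rewrite wE cVe chie.
Qed.

(** There is a hub [inr w] for every map [w], not only for copies of the pattern. The surplus does
    no harm: a minimal subhypergraph must contain some hub, and every hub has low degree. *)
Lemma low_degree_ramsey : exists (T : finType) (G : hypergraph 3 T),
  minimal_ramsey k G (complete 3 t) /\ min_degree G <= n ^ 2.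
Proof.
have [V [cV [cV3 cVf arrow]]] := arrow_pattern.
pose T := (V + {ffun 'I_n -> V})%type.
pose spoke (w : {ffun 'I_n -> V}) (a b : 'I_n) : {set T} := [set inr w; inl (w a);
  inl (w b)].
pose E : {set {set T}} := (fun e : {set V} =>
  inl @: e : {set T}) @: [set e : {set V} | cV e != None] :|:
  [set e : {set T} | (#|e| == 3) && [exists w, exists a, exists b, e == spoke w a b]].
have E3 : E \subset [set e : {set T} | (e \subset [set: T]) && (#|e| == 3)].
  apply/subsetP => e; rewrite !inE subsetT /= => /orP[/imsetP[e0 + ->]|/andP[]//].
  by rewrite inE card_imset; [case def_c: (cV e0) => [i|//] _;
    rewrite (cV3 _ _ def_c) | move=> x y []].
pose H := Hypergraph E3.
have inlI : injective (inl : V -> T) by move=> x y [].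
have HR : ramsey k H (complete 3 t).
  move=> c; apply/mono_copy_completeP.
  have [[A [i [cardA monoA]]]|[w wI hit]] := arrow (fun e => c (inl @: e)).
    exists (inl @: A), i; split; rewrite ?subsetT ?card_imset // => e eA e3.
    have [e0 [e0A def_e e03]] := subset_imset_preim inlI eA.
    have [|cVe ce] := monoA e0 e0A; first by rewrite e03.
    rewrite def_e; split=> //; apply/setUP; left; apply/imsetP; exists e0 => //.
    by rewrite inE.
  have [|i [B [cardB dB monoB]]] := hit (fun a b => c (spoke w a b)).
    by move=> a b; rewrite /spoke setUAC.
  have lwI : injective (inl \o w : 'I_n -> T) by apply: inj_comp.
  exists (inr w |: (inl \o w) @: B), i; split; rewrite ?subsetT //.
    have wB : inr w \notin (inl \o w : 'I_n -> T) @: B by apply/imsetP => -[].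
    by rewrite cardsU1 wB card_imset // cardB add1n prednK // (leq_trans _ t_gt3).
  move=> e eA e3.
  have [we|we] := boolP (inr w \in e).
    have [|e0 [e0B def_e e0e]] := @subset_imset_preim _ _ _ B (e :\ inr w) lwI.
      apply/subsetP => x; rewrite !inE => /andP[xw /(subsetP eA)].
      by rewrite !inE (negPf xw).
    have e02 : #|e0| = 2.
      by rewrite e0e; apply/succn_inj; rewrite -e3 (cardsD1 (inr w) e) we.
    have /eqP/cards2P[a [b [ab def_e0]]] := e02.
    have def_e' : e = spoke w a b.
      by rewrite -(setD1K we) def_e def_e0 imsetU !imset_set1 /spoke setUA.
    have [Ba Bb] : a \in B /\ b \in B.
      by split; apply: (subsetP e0B); rewrite def_e0 !inE eqxx ?orbT.
    split; last by rewrite def_e' dB.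
    apply/setUP; right; rewrite inE e3 eqxx; apply/existsP; exists w.
    by apply/existsP; exists a; apply/existsP; exists b; rewrite def_e'.
  have [|e0 [e0B def_e e0e]] := @subset_imset_preim _ _ _ B e lwI.
    apply/subsetP => x ex; have := subsetP eA x ex; rewrite !inE.
    by case/predU1P=> [xw|//]; rewrite -xw ex in we.
  have [|cVe ce] := monoB e0 e0B; first by rewrite e0e.
  rewrite def_e imset_comp; split=> //; apply/setUP; left; apply/imsetP.
  by exists (w @: e0); rewrite ?inE.
have [G GH minG] := ramsey_minimal HR; exists T, G; split=> //.
have /andP[_ /subsetP GE] := GH.
have [w Gw] : exists w, inr w \in verts G.
  case: (pickP (fun w => inr w \in verts G)) => [w Gw|noG]; first by exists w.
  (* Without hubs [cV] itself would colour [G] with no monochromatic clique on [t] vertices; [i0]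
     fills in for sets that are not edges of [cV]. *)
  have i0 : 'I_k by exists 0; apply: ltnW.
  have [GR _] := minG; have /mono_copy_completeP[A [i [cardA AV AE]]] :=
    GR (fun e => odflt i0 (cV (inl @^-1: e))).
  have def_A : inl @: (inl @^-1: A) = A.
    apply/setP => x; apply/imsetP/idP => [[y]|Ax]; first by rewrite inE => Ay ->.
    case: x Ax => [y|w] Ax; first by exists y; rewrite ?inE.
    by have := subsetP AV _ Ax; rewrite noG.
  have cardA' : #|(inl : V -> T) @^-1: A| = t by rewrite -(card_imset _ inlI) def_A.
  case: (cVf _ i cardA') => e eA e3.
  have [||Ge ce] := AE (inl @: e).
  - by rewrite -def_A imsetS.
  - by rewrite card_imset.
  have preK : inl @^-1: ((inl : V -> T) @: e) = e.
    by apply/setP => x; rewrite inE mem_imset.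
  rewrite preK in ce; case/setUP: (GE _ Ge).
    case/imsetP => e' + /(imset_inj inlI) def_e; rewrite -def_e inE.
    by case: (cV e) ce => //= j ->.
  rewrite inE => /andP[_ /existsP[w /existsP[a /existsP[b /eqP es]]]].
  by have : inr w \in (inl : V -> T) @: e; [rewrite es !inE eqxx | case/imsetP].
apply: leq_trans (leq_min_degree Gw) _; rewrite /degree.
apply: (@leq_trans #|[set spoke w p.1 p.2 | p : 'I_n * 'I_n]|).
  apply: subset_leq_card; apply/subsetP => e; rewrite inE => /andP[/GE].
  case/setUP => [/imsetP[e0 _ ->] /imsetP[]//|].
  rewrite inE => /andP[_ /existsP[w' /existsP[a /existsP[b /eqP es]]]].
  rewrite es !inE /= !orbF => /eqP[ww']; apply/imsetP; exists (a, b) => //=.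
  by rewrite ww'.
apply: leq_trans (leq_imset_card _ _) _.
by rewrite card_prod card_ord mulnn.
Qed.

End UpperBound.

(** * The lower bounds *)

(* A proper colouring with the fewest colours has an edge between any two of
   its classes. *)
Lemma proper_coloring_few (T : finType) (L : {set {set T}}) :
  exists (q : nat) (f : T -> 'I_q),
    (forall a b, a != b -> [set a; b] \in L -> f a != f b) /\ 'C(q, 2) <= #|L|.
Proof.
pose proper (f : {ffun T -> T}) :=
  [forall a, forall b, (a != b) && ([set a; b] \in L) ==> (f a != f b)].
have properP (f : {ffun T -> T}) :
    reflect (forall a b, a != b -> [set a; b] \in L -> f a != f b) (proper f).
  apply: (iffP forallP) => [P a b ab Lab|P a].
    by have /forallP/(_ b) := P a; rewrite ab Lab.
  by apply/forallP => b; apply/implyP => /andP[ab Lab]; apply: P.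
have proper_id : proper [ffun x => x] by apply/properP => a b ab _; rewrite !ffunE.
case: (arg_minnP (fun f : {ffun T ->
  T} => #|f @: [set: T]|) proper_id) => f /properP fP fmin.
set I := f @: [set: T] in fmin.
have idx x : index (f x) (enum I) < #|I| by rewrite cardE index_mem mem_enum imset_f.
exists #|I|, (fun x => Ordinal (idx x)); split.
  move=> a b ab Lab; have := fP a b ab Lab; apply: contraNneq => -[].
  by move=> eq_idx; have := congr1 (nth (f a) (enum I)) eq_idx;
    rewrite !nth_index ?mem_enum ?imset_f // => ->.
rewrite -cards_draws; apply: leq_trans (leq_imset_card (fun e : {set T} => f @: e) _).
apply: subset_leq_card; apply/subsetP => P;
  rewrite inE => /andP[PI /cards2P[x [y [xy def_P]]]].
have [Ix Iy] : x \in I /\ y \in I by split; apply: (subsetP PI);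
  rewrite def_P !inE eqxx ?orbT.
case: (boolP (P \in (fun e : {set T} => f @: e) @: L)) => // noP.
(* If no edge of [L] joins the classes [x] and [y], merging them gives a proper colouring with fewer
   colours. *)
pose g := [ffun z => if f z == y then x else f z].
have gI : g @: [set: T] \subset I :\ y.
  apply/subsetP => _ /imsetP[z _ ->]; rewrite ffunE.
  have [zy|zy] := eqVneq (f z) y; first by rewrite in_setD1 xy.
  by rewrite in_setD1 zy imset_f.
have : proper g.
  apply/properP => a b ab Lab; rewrite !ffunE; have fab := fP a b ab Lab.
  have nP : f @: [set a; b] != P by apply: contraNneq noP => <-; apply: imset_f.
  have [ay|_] := eqVneq (f a) y; have [by_|_] := eqVneq (f b) y => //.
    by rewrite ay by_ eqxx in fab.
    by apply: contraNneq nP => xb; rewrite imsetU !imset_set1 def_P ay -xb setUC.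
  by apply: contraNneq nP => ax; rewrite imsetU !imset_set1 def_P by_ ax.
move/fmin => /leq_trans/(_ (subset_leq_card gI)).
by rewrite [X in X <= _](cardsD1 y) Iy ltnn.
Qed.

(** Edges at [v] are coloured by pulling back a good colouring on fewer than [r] points along a
    proper colouring [f] of the link. In a monochromatic clique through [v] all pairs avoiding [v]
    are in the link, so [f] is injective there and would produce a monochromatic clique on [t.-1]
    points. *)
Lemma degree_lower_bound (t k r : nat) (T : finType) (G : hypergraph 3 T) (v : T) :
  0 < t -> is_graph_ramsey_number k t.-1 r ->
  minimal_ramsey k G (complete 3 t) -> v \in verts G -> 'C(r, 2) <= degree G v.
Proof.
move=> t_gt0 [_ rmin] [GR Gmin] Gv; rewrite leqNgt; apply/negP => ltdeg.
pose E' := [set e in edges G | v \notin e].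
have E'u : E' \subset [set e : {set T} | (e \subset verts G :\ v) && (#|e| == 3)].
  apply/subsetP => e; rewrite inE => /andP[Ge ve].
  have := subsetP (edges_uniform G) e Ge; rewrite !inE => /andP[eG ->].
  rewrite andbT; apply/subsetP => x ex; rewrite !inE (subsetP eG) // andbT.
  by apply: contraNneq ve => <-.
pose G' := Hypergraph E'u.
have /Gmin : proper_subhypergraph G' G.
  apply/andP; split.
    apply/andP; split; first exact: subsetDl.
    by apply/subsetP => e; rewrite inE => /andP[].
  by apply/negP => /andP[/subsetP/(_ v Gv)]; rewrite !inE eqxx.
move/existsNP => [c nc].
pose L := [set e :\ v | e in [set e in edges G | v \in e]].
have [q [f [fP qL]]] := proper_coloring_few L.
have ltqr : q < r.
  rewrite ltnNge; apply/negP => /(leq_bin2l 2) leC.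
  have := leq_trans (leq_trans leC qL) (leq_imset_card _ _).
  by rewrite leqNgt ltdeg.
have /existsNP[g ng] : ~ ramsey k (complete 2 q) (complete 2 t.-1).
  by move/rmin; rewrite leqNgt ltqr.
pose c' (e : {set T}) := if v \in e then g (f @: (e :\ v)) else c e.
have /mono_copy_completeP[A [i [cardA AG AE]]] := GR c'.
have [Av|nAv] := boolP (v \in A); last first.
  apply: nc; apply/mono_copy_completeP; exists A, i; split=> //.
    apply/subsetP => x Ax; rewrite !inE (subsetP AG) // andbT.
    by apply: contraNneq nAv => <-.
  move=> e eA e3; have [Ge ce] := AE e eA e3.
  have ve : v \notin e by apply: contra nAv; apply/subsetP.
  by rewrite inE Ge ve -ce /c' (negPf ve).
have pairA a b : a \in A :\ v -> b \in A :\ v -> a != b ->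
    [set a; b] \in L /\ g [set f a; f b] = i.
  rewrite !inE => /andP[av Aa] /andP[bv Ab] ab; pose e := v |: [set a; b].
  have ev : v \notin [set a; b] by rewrite !inE negb_or ![v == _]eq_sym av.
  have [||Ge ce] := AE e.
  - by rewrite !subUset !sub1set Av Aa.
  - by rewrite cardsU1 ev cards2 ab.
  have eD : e :\ v = [set a; b] by rewrite setU1K.
  split; first by apply/imsetP; exists e; rewrite ?eD // inE Ge !inE eqxx.
  by rewrite -ce /c' !inE eqxx /= eD imsetU !imset_set1.
have fI : {in A :\ v &, injective f}.
  move=> a b Aa Ab fab; apply/eqP/negPn/negP => ab.
  by have := fP a b ab (pairA a b Aa Ab ab).1; rewrite fab eqxx.
apply: ng; apply/mono_copy_completeP; exists (f @: (A :\ v)), i; split.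
- by rewrite card_in_imset //; apply/succn_inj;
  rewrite prednK // -cardA [in RHS](cardsD1 v A) Av.
- by rewrite subsetT.
- move=> e eA e2; rewrite inE e2 eqxx; split=> //.
  have /eqP/cards2P[x [y [xy def_e]]] := e2.
  have [/imsetP[a Aa def_x] /imsetP[b Ab def_y]] : x \in f @: (A :\ v) /\ y \in f @:
    (A :\ v).
    by split; apply: (subsetP eA); rewrite def_e !inE eqxx ?orbT.
  rewrite def_e def_x def_y; apply: (pairA a b Aa Ab _).2.
  by apply: contraNneq xy; rewrite def_x def_y => ->.
Qed.

(** * Exponential lower bound for graph Ramsey numbers *)

Definition avoids (T C : finType) (m : nat) (c : T -> T -> C) : Prop :=
  (forall a b, c a b = c b a) /\
  forall (A : {set T}) i, #|A| = m -> ~ {in A &, forall a b, a != b -> c a b = i}.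

(** Lexicographic product: a monochromatic set with a colour of the first factor projects
    injectively to that factor, and one with a colour of the second factor lies in a single
    fibre. *)
Lemma avoids_product (T1 T2 C1 C2 : finType) (m : nat)
    (c1 : T1 -> T1 -> C1) (c2 : T2 -> T2 -> C2) :
  avoids m c1 -> avoids m c2 ->
  exists c : T1 * T2 -> T1 * T2 -> C1 + C2, avoids m c.
Proof.
move=> [sym1 av1] [sym2 av2].
exists (fun a b => if a.1 == b.1 then inr (c2 a.2 b.2) else inl (c1 a.1 b.1)).
split=> [a b|A [i|i] cardA mono]; first by rewrite eq_sym sym1 sym2.
  have fI : {in A &, injective fst}.
    move=> a b Aa Ab ab; apply/eqP/negPn/negP => /(mono a b Aa Ab).
    by rewrite ab eqxx.
  apply: (av1 (fst @: A) i); first by rewrite card_in_imset.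
  move=> _ _ /imsetP[a Aa ->] /imsetP[b Ab ->] ab.
  have ab' : a != b by apply: contraNneq ab => ->.
  by have := mono a b Aa Ab ab'; rewrite (negPf ab) => -[].
have same : {in A &, forall a b, a.1 = b.1}.
  move=> a b Aa Ab; have [->//|] := eqVneq a b.
  by move/(mono a b Aa Ab); case: eqP.
have sI : {in A &, injective snd}.
  by move=> [a1 a2] [b1 b2] Aa Ab /= ->; have /= -> := same _ _ Aa Ab.
apply: (av2 (snd @: A) i); first by rewrite card_in_imset.
move=> _ _ /imsetP[a Aa ->] /imsetP[b Ab ->] ab.
have ab' : a != b by apply: contraNneq ab => ->.
by have := mono a b Aa Ab ab'; rewrite (same a b Aa Ab) eqxx => -[].
Qed.

Lemma avoids_not_ramsey (T C : finType) (i0 : C) (k m r : nat) (c : T -> T -> C) :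
  #|C| = k -> avoids m c -> ramsey k (complete 2 r) (complete 2 m) -> #|T| < r.
Proof.
move=> <- [csym cav] rR; rewrite ltnNge; apply/negP => lerT.
pose h (x : 'I_r) : T := enum_val (widen_ord lerT x).
have hI : injective h by move=> x y /enum_val_inj/(congr1 val)/=/val_inj.
have [c0 c0P] := symmetric_set_fun i0 (fun x y => csym (h x) (h y)).
have /mono_copy_completeP[A [i [cardA _ AE]]] := rR (fun e => enum_rank (c0 e)).
apply: (cav (h @: A) (enum_val i)); first by rewrite card_imset.
move=> _ _ /imsetP[x Ax ->] /imsetP[y Ay ->] hxy.
have xy : x != y by apply: contraNneq hxy => ->.
have [||_ <-] := AE [set x; y]; first by rewrite subUset !sub1set Ax.
  by rewrite cards2 xy.
by rewrite enum_rankK c0P.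
Qed.

(** The expected number of monochromatic [m]-sets in a uniform random colouring is
    ['C(N, m) * q / q ^ 'C(m, 2)], less than one. *)
Lemma first_moment (N m q : nat) : 0 < q -> 'C(N, m) * q < q ^ 'C(m, 2) ->
  exists c : 'I_N -> 'I_N -> 'I_q, avoids m c.
Proof.
move=> q_gt0 ltC; pose K := #|[set: {ffun {set 'I_N} -> 'I_q}]|.
pose D (A : {set 'I_N}) := {e : {set 'I_N} | e \in [set e : {set 'I_N}
  | (e \subset A) && (#|e| == 2)]}.
pose Bad (p : {set 'I_N} * 'I_q) := [set c : {ffun {set 'I_N} -> 'I_q} |
  [ffun e : D p.1 => c (val e)] == [ffun=> p.2]].
have cardBad (p : {set 'I_N} * 'I_q) : #|p.1| = m -> #|Bad p| * q ^ 'C(m, 2) = K.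
  move=> pm; have := @card_comp_fiber (D p.1) _ _ val [ffun=> p.2] val_inj.
  by rewrite card_sig cards_draws pm card_ord /K cardsT card_ffun card_ord => ->.
have K_gt0 : 0 < K by rewrite /K cardsT card_ffun card_ord expn_gt0 q_gt0.
pose U := \bigcup_(p : {set 'I_N} * 'I_q | #|p.1| == m) Bad p.
have ltU : #|U| < K.
  rewrite -(@ltn_pmul2r (q ^ 'C(m, 2))) ?expn_gt0 ?q_gt0 //.
  apply: (@leq_ltn_trans ('C(N, m) * q * K)); last by rewrite mulnC ltn_pmul2l.
  apply: leq_trans (leq_mul (card_bigcup_le _ _) (leqnn _)) _.
  rewrite big_distrl /=; apply: leq_trans (leq_sum_const (b := K) _) _.
    by move=> p /eqP pm; rewrite cardBad.
  rewrite leq_mul2r; apply/orP; right.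
  have -> : 'C(N, m) * q = #|setX [set A : {set 'I_N} | #|A| == m] [set: 'I_q]|.
    by rewrite cardsX card_draws cardsT !card_ord.
  by apply: subset_leq_card; apply/subsetP => p pm; rewrite !inE andbT.
have [c Uc] : exists c, c \notin U.
  case: (pickP [pred c | c \notin U]) => [c|allU]; first by exists c.
  move: ltU; rewrite ltnNge; case/negP; apply: subset_leq_card.
  by apply/subsetP => c _; have := allU c; rewrite /= => /negbFE.
exists (fun a b => c [set a; b]); split=> [a b|A i cardA mono]; first by rewrite setUC.
case/negP: Uc; apply/bigcupP; exists (A, i); first by rewrite /= cardA.
rewrite inE; apply/eqP/ffunP => -[e eD]; rewrite !ffunE /=.
move: eD; rewrite inE => /andP[eA /cards2P[a [b [ab def_e]]]].
rewrite def_e; apply: mono => //; apply: (subsetP eA); rewrite def_e !inE eqxx ?orbT //.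
Qed.

Lemma first_moment_power (m q e : nat) : q < m`! -> 0 < q ->
  (2 ^ e) ^ m <= q ^ 'C(m, 2) ->
  exists c : 'I_(2 ^ e) -> 'I_(2 ^ e) -> 'I_q, avoids m c.
Proof.
move=> qm q_gt0 leQ; apply: first_moment => //; apply: leq_trans leQ.
case: (posnP 'C(2 ^ e, m)) => [->|C_gt0]; first by rewrite mul0n !expn_gt0.
apply: (@leq_trans ('C(2 ^ e, m) * m`!)); first by rewrite ltn_pmul2l.
rewrite bin_ffact; have := card_inj_ffuns 'I_m 'I_(2 ^ e).
rewrite !card_ord => <-; apply: leq_trans (max_card _) _.
by rewrite card_ffun !card_ord.
Qed.

(* The random bound for two and three colours, amplified by products. *)
Lemma avoids_power (m k : nat) : 2 < m -> 1 < k ->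
  exists (T C : finType) (c : T -> T -> C) (e : nat),
    [/\ avoids m c, #|C| = k, #|T| = 2 ^ e & k * m.-1./2 <= 2 * e + 1].
Proof.
move=> m_gt2; set h := m.-1./2; have hm : 2 * h <= m.-1 by rewrite /h; lia.
have fact_m : 3 < m`! by apply: leq_trans (leq_fact m_gt2).
have binm : 2 * 'C(m, 2) = m * m.-1 by rewrite -mul_bin_diag bin1.
have [c2 av2] : exists c : 'I_(2 ^ h) -> 'I_(2 ^ h) -> 'I_2, avoids m c.
  apply: first_moment_power => //; first exact: ltnW.
  by rewrite -expnM leq_exp2l // -(leq_pmul2l (isT : 0 < 2)) binm; nia.
(* With three colours the exponent grows by half because [2 ^ 3 <= 3 ^ 2]. *)
have [c3 av3] : exists c : 'I_(2 ^ (3 * h)./2) -> 'I_(2 ^ (3 * h)./2) ->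
  'I_3, avoids m c.
  apply: first_moment_power => //; rewrite -expnM -(@leq_exp2r _ _ 2) // -!expnM.
  apply: (@leq_trans (2 ^ (3 * (h * m)))); first by rewrite leq_exp2l //; nia.
  apply: (@leq_trans (3 ^ (2 * (h * m)))); first by rewrite !expnM !leq_exp2r; nia.
  by rewrite leq_exp2l // [X in _ <= X]mulnC binm; nia.
(* Two more colours add [h] to [e]; the slack [+ 1] pays for the rounding of [(3 * h)./2] when [k]
   is odd. *)
elim/ltn_ind: k => -[|[|[|[|k]]]] // IHk _.
- by exists 'I_(2 ^ h), 'I_2, c2, h; split; rewrite ?card_ord //; lia.
- by exists 'I_(2 ^ (3 * h)./2), 'I_3, c3, (3 * h)./2; split; rewrite ?card_ord //; lia.
have [|//|T [C [c [e [av cardC cardT le_e]]]]] := IHk k.+2;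
  first by rewrite ltnS leqnSn.
have [c' av'] := avoids_product av av2.
exists (T * 'I_(2 ^ h))%type, (C + 'I_2)%type, c', (e + h); split=> //.
- by rewrite card_sum cardC card_ord addn2.
- by rewrite card_prod cardT card_ord expnD.
- by lia.
Qed.

Lemma graph_ramsey_exists (k m : nat) : 0 < k -> exists r, is_graph_ramsey_number k m r.
Proof.
move=> k_gt0; set N := ramsey_bound #|'I_k| 1 (\sum_(j : 'I_k) m).
suff NR : ramsey k (complete 2 N) (complete 2 m).
  by have [r rmin _] := exists_least (P :=
    fun N => ramsey k (complete 2 N) (complete 2 m)) NR; exists r.
move=> c; apply/mono_copy_completeP.
have [|i [A [_ cardA monoA]]] := @ramsey_sets 1 _ (Ordinal k_gt0) (fun=> m) _ [set:
  'I_N] c.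
  by rewrite cardsT [X in _ <= X]card_ord.
exists A, i; split=> // [|e eA e2]; first exact: subsetT.
by split; [rewrite inE e2 | apply: monoA].
Qed.

Lemma graph_ramsey_lower (k m r : nat) : 2 < m -> 1 < k ->
  is_graph_ramsey_number k m r ->
  2 ^ (k * m.-1./2) <= 4 * 'C(r, 2).
Proof.
move=> m_gt2 k_gt1 [rR _].
have [T [C [c [e [av cardC cardT le_e]]]]] := avoids_power m_gt2 k_gt1.
have /card_gt0P[i0 _] : 0 < #|C| by rewrite cardC ltnW.
have := avoids_not_ramsey i0 cardC av rR; rewrite cardT => lt_r.
(* From [r > 2 ^ e] follows [4 * 'C(r, 2) >= 2 * (2 ^ e) ^ 2]. *)
apply: (@leq_trans (2 ^ (2 * e + 1))); first by rewrite leq_exp2l.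
have leC := leq_bin2l 2 lt_r; have eqC : 2 * 'C((2 ^ e).+1, 2) = (2 ^ e).+1 * 2 ^ e.
  by rewrite -mul_bin_diag bin1.
rewrite addn1 expnS (mulnC 2 e) expnM -mulnn; nia.
Qed.

Lemma smallest_min_degree (t k r : nat) : 3 < t -> 1 < k ->
  is_graph_ramsey_number k t.-1 r ->
  exists2 s, is_smallest_min_degree k t s & 'C(r, 2) <= s <= k ^ (20 * k * t ^ 4).
Proof.
move=> t_gt3 k_gt1 rP; have [T [G [minG degG]]] := low_degree_ramsey t_gt3 k_gt1.
have [|s sP le_s] := exists_least (n := min_degree G)
  (P := fun d => exists (T : finType) (G : hypergraph 3 T),
    minimal_ramsey k G (complete 3 t) /\ min_degree G = d).
  by exists T, G.
exists s => //; apply/andP; split; last first.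
  apply: leq_trans le_s (leq_trans degG _); rewrite -expnM leq_exp2l //.
  by move: (t ^ 4) => u; lia.
have [[T' [G' [minG' <-]]] _] := sP.
apply: min_degree_geq => [|v Gv]; last first.
  by apply: degree_lower_bound rP minG' Gv; apply: leq_trans t_gt3.
(* A Ramsey hypergraph contains a clique, hence a vertex, so the default value in [min_degree] does
   not intervene. *)
have [GR _] := minG'; have i0 : 'I_k by exists 0; apply: ltnW.
have /mono_copy_completeP[A [_ [cardA AG _]]] := GR (fun=> i0).
have /card_gt0P[x Ax] : 0 < #|A| by rewrite cardA (leq_trans _ t_gt3).
by exists x; apply: (subsetP AG).
Qed.

(* Passage to real exponents *)
From mathcomp Require Import all_boot all_order all_algebra.
From mathcomp Require Import all_classical all_reals all_analysis.
From mathcomp Require Import lra.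
Import Order.TTheory GRing.Theory Num.Theory.
Import numFieldNormedType.Exports.
Local Open Scope classical_set_scope.
Local Open Scope ring_scope.

(** Rounding [t.-2./2] down to at least [(t - 3) / 2] costs at most [3 * k / 2] against [k * t / 2],
    while the term [10 / (t + 1)] grants at least [5 * k / 2]; the difference [k >= 2] covers
    [4 = 2 ^ 2]. *)
Lemma powR_le_natexp (R : realType) (t k : nat) : (4 <= t)%N -> (2 <= k)%N ->
  4 * 2 `^ (2^-1 * k%:R * t%:R * (1 - 10 * t.+1%:R^-1)) <= (2 ^ (k * t.-2./2))%:R :> R.
Proof.
move=> t4 k2; have four : 4 = 2 `^ 2 :> R by rewrite -(natr1 _) powR_mulrn // expr2;
  lra.
rewrite {1}four -powRD; last by rewrite pnatr_eq0 implybT.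
rewrite natrX -powR_mulrn //; apply: ler_powR; first by rewrite ler1n.
set u : R := t.+1%:R^-1; have u_t : 5 <= t%:R * (10 * u).
  have t0 : 0 < t.+1%:R :> R by rewrite ltr0n.
  have u0 : 0 <= u by rewrite invr_ge0 ltW.
  have : 5 * t.+1%:R <= 10 * t%:R :> R by rewrite -!natrM ler_nat; lia.
  have uT : t.+1%:R * u = 1 by rewrite /u mulfV ?gt_eqF.
  by move=> /(ler_wpM2r u0); rewrite -mulrA uT; lra.
have h_t : (t%:R - 3 <= 2 * (t.-2./2)%:R :> R).
  by rewrite lerBlDr -!natrM -natrD ler_nat; lia.
have k2' : 2 <= k%:R :> R by rewrite ler_nat.
rewrite natrM.
have : k%:R * 5 <= k%:R * (t%:R * (10 * u)) :> R by rewrite ler_pM2l // ltr0n ltnW.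
have : k%:R * (t%:R - 3) <= k%:R * (2 * (t.-2./2)%:R) :> R by rewrite ler_pM2l //
  ltr0n ltnW.
lra.
Qed.

Theorem theorem1p1 (R : realType) :
  exists eps : nat -> R,
    eps n @[n --> \oo] --> (0 : R) /\
    forall t k : nat, (4 <= t)%N -> (2 <= k)%N ->
      exists r s : nat,
        [/\ is_graph_ramsey_number k t.-1 r,
            is_smallest_min_degree k t s,
            2 `^ (2^-1 * k%:R * t%:R * (1 - eps t)) <= ('C(r, 2))%:R :> R,
            ('C(r, 2) <= s)%N
          & (s <= k ^ (20 * k * t ^ 4))%N].
Proof.
exists (fun n => 10 * n.+1%:R^-1); split.
  by rewrite -[X in _ --> X](mulr0 10); apply: cvgMr; apply: cvg_harmonic.
move=> t k t4 k2; have [r rP] := graph_ramsey_exists t.-1 (ltnW k2).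
have [s sP /andP[rs sk]] := smallest_min_degree t4 k2 rP.
exists r, s; split=> //.
have m3 : (2 < t.-1)%N by rewrite -ltnS prednK // ltnW // ltnW // ltnW.
have := graph_ramsey_lower m3 k2 rP; rewrite -(ler_nat R) natrM.
move/(le_trans (powR_le_natexp R t4 k2)).
by rewrite ler_pM2l // ltr0n.
Qed.
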